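(* If a tree $T$ satisfies one of the following conditions, then it is not $e$-positive: (1) $T$ has no pendent $P_2$; (2) $T$ has exactly one pendent $P_2$ and at least one pendent claw $K_{1,3}$; (3) $T$ has exactly two pendent $P_2$'s and no pendent $P_4$.
   Context: Chromatic symmetric function: for a graph $G$ with vertices $v_1,\dots,v_d$, $X_G=\sum_\kappa x_{\kappa(v_1)}\cdots x_{\kappa(v_d)}$, the sum over all proper colorings $\kappa:V(G)\to\{1,2,\dots\}$ (i.e., $\kappa(u)\neq\kappa(v)$ for every edge $uv$). For an integer partition $\lambda=(\lambda_1,\dots,\lambda_\ell)$, $e_\lambda=e_{\lambda_1}\cdots e_{\lambda_\ell}$ with $e_k=\sum_{1\le j_1<\cdots<j_k}x_{j_1}\cdots x_{j_k}$. A graph $G$ is $e$-positive if all coefficients of $X_G$ in the basis $\{e_\lambda\}$ are non-negative. $P_k$ is the path on $k$ vertices and $K_{1,3}$ is the claw (star with three leaves). A tree $T$ has a pendent (graph) $G$ if there is a cut edge $f$ of $T$ such that $T-f$ has two connected components with one component being isomorphic to $G$; pendent copies are counted as such components.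
   Formalization: Five small trees are excluded, each of which satisfies a condition yet is e-positive, so the claim fails for it: P_1 and P_2 (condition 1), the spider with legs 2, 1, 1 (condition 2), P_3 and P_4 (condition 3). *)

(* Defs.v *)
From HB Require Import structures.
From mathcomp Require Import all_boot all_order all_algebra.
From mathcomp Require Import finmap mpoly.

Set Implicit Arguments.
Unset Strict Implicit.
Unset Printing Implicit Defensive.

Import GRing.Theory Num.Theory.
Local Open Scope ring_scope.

Record sgraph := SGraph {
  vertex :> finType;
  edge : rel vertex;
  edge_sym : ssrbool.symmetric edge;
  edge_irrefl : irreflexive edge }.

Definition isomorphic (G H : sgraph) : bool :=
  (#|G| == #|H|) &&
  [exists f : {ffun G -> H},
     injectiveb f && [forall x, forall y, edge (f x) (f y) == edge x y]].

Definition components (G : sgraph) : {set {set G}} :=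
  equivalence_partition (connect (@edge G)) [set: G].

(* A [ucycle] of size at most 2 is a vertex or an edge traversed back and
   forth, so the last condition says that there is no graph-theoretic cycle. *)
Definition is_tree (G : sgraph) : Prop :=
  [/\ (0 < #|G|)%N,
      forall x y : G, connect (@edge G) x y
    & forall p : seq G, ucycle (@edge G) p -> (size p <= 2)%N].

Section Subgraphs.
Variable G : sgraph.

Section DelEdge.
Variables u v : G.

Definition del_edge_rel : rel G :=
  [rel x y | edge x y && ([set x; y] != [set u; v])].

Lemma del_edge_sym : ssrbool.symmetric del_edge_rel.
Proof. by move=> x y; rewrite /del_edge_rel /= edge_sym setUC. Qed.

Lemma del_edge_irrefl : irreflexive del_edge_rel.
Proof. by move=> x; rewrite /del_edge_rel /= edge_irrefl. Qed.

Definition del_edge : sgraph := SGraph del_edge_sym del_edge_irrefl.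

Definition cut_edge : bool :=
  edge u v && (#|components G| < #|components del_edge|)%N.
End DelEdge.

Section Induced.
Variable C : {set G}.

Definition induced_rel : rel {x : G | x \in C} :=
  [rel x y | edge (val x) (val y)].

Lemma induced_sym : ssrbool.symmetric induced_rel.
Proof. by move=> x y; rewrite /induced_rel /= edge_sym. Qed.

Lemma induced_irrefl : irreflexive induced_rel.
Proof. by move=> x; rewrite /induced_rel /= edge_irrefl. Qed.

Definition induced : sgraph := SGraph induced_sym induced_irrefl.
End Induced.
End Subgraphs.

(* A pendent copy is recorded by its vertex set; an edge whose removal leaves
   two components isomorphic to [H] contributes both of them. *)
Definition pendent (T H : sgraph) : {set {set T}} :=
  [set C : {set T} | [exists u : T, exists v : T,
     [&& cut_edge u v,
         #|components (del_edge u v)| == 2%N,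
         C \in components (del_edge u v)
       & isomorphic (@induced (del_edge u v) C) H]]].

Definition path_rel k : rel 'I_k :=
  [rel i j : 'I_k | (i.+1 == j :> nat) || (j.+1 == i :> nat)].

Lemma path_rel_sym k : ssrbool.symmetric (@path_rel k).
Proof. by move=> i j; rewrite /path_rel /= orbC. Qed.

Lemma path_rel_irrefl k : irreflexive (@path_rel k).
Proof. by move=> i; rewrite /path_rel /= orbb gtn_eqF. Qed.

Definition path_graph k : sgraph := SGraph (@path_rel_sym k) (@path_rel_irrefl k).

Definition bipartite_rel m n : rel ('I_m + 'I_n)%type :=
  [rel x y | is_inl x != is_inl y].

Lemma bipartite_rel_sym m n : ssrbool.symmetric (@bipartite_rel m n).
Proof. by move=> x y; rewrite /bipartite_rel /= eq_sym. Qed.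

Lemma bipartite_rel_irrefl m n : irreflexive (@bipartite_rel m n).
Proof. by move=> x; rewrite /bipartite_rel /= eqxx. Qed.

Definition complete_bipartite m n : sgraph :=
  SGraph (@bipartite_rel_sym m n) (@bipartite_rel_irrefl m n).

Definition claw : sgraph := complete_bipartite 1 3.

Definition fork_rel : rel 'I_5 :=
  let E : seq (nat * nat) := [:: (0, 1); (0, 2); (0, 3); (3, 4)]%N in
  [rel i j : 'I_5 | ((val i, val j) \in E) || ((val j, val i) \in E)].

Lemma fork_rel_sym : ssrbool.symmetric fork_rel.
Proof. by move=> i j; rewrite /fork_rel /= orbC. Qed.

Lemma fork_rel_irrefl : irreflexive fork_rel.
Proof. by case; do 5?[case=> //]. Qed.

(* The spider with legs of lengths 2, 1, 1. *)
Definition fork : sgraph := SGraph fork_rel_sym fork_rel_irrefl.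

Definition proper_coloring (G : sgraph) n (k : {ffun G -> 'I_n}) : bool :=
  [forall u, forall v, edge u v ==> (k u != k v)].

(* A symmetric function in x_1, x_2, ... is represented by the family, indexed
   by n, of its images under x_i := 0 for i > n (the ring of symmetric functions
   is the inverse limit of the rings of symmetric polynomials in n variables).
   In X_G this substitution keeps exactly the colorings with the first n
   colors; it sends e_k to ['s_(rat, n, k)], which is 0 when k > n. *)
Definition chromsym (G : sgraph) n : {mpoly rat[n]} :=
  \sum_(k : {ffun G -> 'I_n} | proper_coloring k) \prod_(v : G) 'X_(k v).

Definition epart (l : seq nat) n : {mpoly rat[n]} := \prod_(i <- l) mesym n rat i.

Definition is_partition (l : seq nat) : bool :=
  sorted geq l && (0%N \notin l).

(* The coefficients do not depend on n: this is an identity between symmetric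
   functions in infinitely many variables, which determines [c]. *)
Definition e_expansion (G : sgraph) (c : {fsfun seq nat -> rat with 0}) : Prop :=
  (forall l : seq nat, l \in finsupp c -> is_partition l) /\
  forall n, chromsym G n = \sum_(l <- finsupp c) c l *: epart l n.

Definition e_positive (G : sgraph) : Prop :=
  exists c, e_expansion G c /\ forall l : seq nat, 0 <= c l.

(* The trees that satisfy one of the conditions on pendent subgraphs and are
   nevertheless e-positive: P_1 and P_2 have no pendent P_2, the fork has one
   pendent P_2 and one pendent claw, P_3 and P_4 have two pendent P_2 and no
   pendent P_4. *)
Definition small_exceptions : seq sgraph :=
  [:: path_graph 1; path_graph 2; path_graph 3; path_graph 4; fork].

(* Main.v *)
Require Import Defs.
From mathcomp Require Import all_boot all_order all_fingroup all_algebra.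
From mathcomp Require Import finmap mpoly.
From mathcomp Require Import ring lra zify.

Set Implicit Arguments.
Unset Strict Implicit.
Unset Printing Implicit Defensive.

Import GRing.Theory Num.Theory.

(** The elementary symmetric functions are algebraically independent, so a ring
may be chosen together with arbitrary values for e_1, ..., e_n in it. Send e_s
to 1, e_m to an indeterminate t, and every other e_k with k > 0 to 0. If X_T is
e-positive, its image is a polynomial in t with non-negative coefficients. The
whole proof consists in choosing s and m so that the coefficient of t is
negative.

For a tree the image is computed from power sums: inclusion-exclusion over the
edges gives X_T as the sum, over the sets of deleted edges, of plus or minus the
product of the p_k for k running over the sizes of the resulting components
[proper_coloring_expansion]. With the tree rooted, an edge is named by its lower
end, so deleting edges amounts to choosing a set D of vertices containing the
root, and the components are the fibers of the map that climbs to the nearest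
ancestor in D. Newton's identities give the image of p_k to first order in t: its
constant term vanishes for 0 < k < s and its t-coefficient vanishes for k < m.
Hence one component must have at least m vertices while the others have at least
s each, so when n - m is a small multiple of s few edges can be deleted.

Call a vertex set a branch when exactly one edge leaves it; the branches are the
two sides of the edges, and the pendent copies of H are the branches that induce
H. Two choices of (s, m) are used.
- With m = n - s, the whole tree contributes -n, and the only other
  contributions come from the branches of size s. So an e-positive tree on n
  vertices has a branch of every size 1 < s < n [branch_of_size].
- With s = 2 and m = n - 4, writing N2 and N4 for the numbers of branches of
  sizes 2 and 4 and N for the number of ways to delete two edges so that two of
  the three components are single edges (dominoes) and the third one is
  distinguished, the coefficient is
  n - 2(n-2) N2 - 2(n-4) N4 + 4(n-4) N [branches_vs_dominoes].

The three conditions follow. If N2 = 0 the first fact with s = 2 applies. In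
the other two cases, a pair of dominoes either consists of two distinct branches
of size 2, or its union is a branch of size 4 that contains a branch of size 2
and induces the path P_4 [two_dominoesP]. If N2 = 1 only the second possibility
remains, N is at most 1 once n > 5, and a pendent claw provides one more branch
of size 4, so N4 > N. If N2 = 2 and no P_4 is pendent only the first possibility
remains, so N is at most 1, while N4 > 0 by the first fact with s = 4. Both times
the second inequality is violated. The trees too small for this count are the
listed exceptions. *)

(** * Newton's identities *)

Local Open Scope ring_scope.

Definition psum n (k : nat) : {mpoly rat[n]} := \sum_(i < n) 'X_i ^+ k.

Section Newton.
Variable n : nat.

Local Notation e := (mesym n rat).

Let e_avoid (i : 'I_n) k : {mpoly rat[n]} :=
  \sum_(h : {set 'I_n} | (#|h| == k) && (i \notin h)) \prod_(j in h) 'X_j.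

Let sum_containing (i : 'I_n) k :
  \sum_(h : {set 'I_n} | (#|h| == k.+1) && (i \in h)) \prod_(j in h) 'X_j
    = 'X_i * e_avoid i k :> {mpoly rat[n]}.
Proof.
rewrite /e_avoid big_distrr /=.
rewrite (reindex_onto (fun h => i |: h) (fun h => h :\ i)) /=; last first.
  by move=> h /andP[_ ih]; rewrite setD1K.
apply: eq_big => [h | h /andP[_ /eqP hi]]; last first.
  have ih: i \notin h by rewrite -hi !inE eqxx.
  by rewrite big_setU1.
rewrite setU11 andbT; have [ih | ih] /= := boolP (i \in h).
  rewrite andbF; apply/negbTE; rewrite negb_and orbC; apply/orP; left.
  by apply/eqP => hh; move: ih; rewrite -hh !inE eqxx.
by rewrite setU1K // eqxx !andbT cardsU1 ih.
Qed.

Let e_split i k : e k.+1 = e_avoid i k.+1 + 'X_i * e_avoid i k.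
Proof.
rewrite -sum_containing /mesym (bigID (fun h : {set 'I_n} => i \in h)) /=.
by rewrite addrC.
Qed.

Let e_avoidE i k :
  'X_i * e_avoid i k = \sum_(j < k.+1) (-1) ^+ j * 'X_i ^+ j.+1 * e (k - j).
Proof.
elim: k => [|k IHk].
  rewrite big_ord1 expr0 mul1r subnn expr1; congr (_ * _).
  rewrite mesym0E /e_avoid (big_pred1 set0) ?big_set0 // => h.
  rewrite cards_eq0 /=; case: eqP => [->|//]; by rewrite inE.
have -> : e_avoid i k.+1 = e k.+1 - 'X_i * e_avoid i k.
  by rewrite (e_split i) addrK.
rewrite IHk [RHS]big_ord_recl /= expr0 mul1r expr1 subn0 mulrBr; congr (_ + _).
rewrite mulr_sumr -sumrN; apply: eq_bigr => j _ /=.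
by rewrite /bump /= add1n subSS !exprS; ring.
Qed.

(** Removing x_i from the variables gives e_k = a_k + x_i a_(k-1), where a_k is
the elementary symmetric function that avoids x_i. Unrolling this recursion
expresses x_i a_k by the e_j, and summing over i counts every product of k + 1
variables k + 1 times. *)
Lemma newton_identity k :
  k.+1%:R * e k.+1 =
    \sum_(j < k.+1) (-1) ^+ j * psum n j.+1 * e (k - j).
Proof.
have -> : k.+1%:R * e k.+1 = \sum_i 'X_i * e_avoid i k.
  under eq_bigr => i _ do rewrite -sum_containing.
  rewrite (exchange_big_dep (fun h : {set 'I_n} => #|h| == k.+1)) /=; last first.
    by move=> i h _ /andP[].
  rewrite /mesym mulr_sumr; apply: eq_bigr => h /eqP hk.
  by rewrite hk eqxx /= sumr_const hk mulr_natl.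
under eq_bigr => i _ do rewrite e_avoidE.
rewrite exchange_big /=; apply: eq_bigr => j _.
by rewrite -mulr_suml -mulr_sumr.
Qed.

End Newton.

(** * Specializing symmetric functions *)

(** The polynomial whose composition with the elementary symmetric polynomials
is e_k: by the fundamental theorem, symmetric polynomials in n variables are
polynomials in these variables. *)
Definition esym_var n k : {mpoly rat[n]} :=
  if k is k'.+1 then if insub k' is Some i then 'X_(i : 'I_n) else 0 else 1.

Arguments esym_var : simpl never.

Section Specialization.
Variables (n : nat) (R : comAlgType rat) (a q : nat -> R).

Let esyms := [tuple mesym n rat i.+1 | i < n].

Lemma psum_sym k : psum n k \is symmetric.
Proof.
apply/issymP => s; rewrite /psum raddf_sum /= [RHS](reindex_inj (@perm_inj _ s)) /=.
apply: eq_bigr => i _; rewrite rmorphXn /=; congr (_ ^+ _).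
rewrite msymX; congr 'X_[_]; apply/mnmP => j; rewrite !mnmE.
by rewrite -(inj_eq (@perm_inj _ s)) permKV.
Qed.

Let P k : {mpoly rat[n]} := sval (sym_fundamental (psum_sym k)).

Let PE k : P k \mPo esyms = psum n k.
Proof. by rewrite /P; case: sym_fundamental => t []. Qed.

Local Notation E := (esym_var n).

Let EE k : E k \mPo esyms = mesym n rat k.
Proof.
case: k => [|k]; rewrite /esym_var ?comp_mpoly1 ?mesym0E //.
case: insubP => [i _ /= <- | hk].
  by rewrite comp_mpolyXU -tnth_nth tnth_mktuple.
by rewrite comp_mpoly0 mesym_geqnE // ltnS leqNgt.
Qed.

Let Phi (t : {mpoly rat[n]}) : R :=
  mmap (in_alg R) (fun i : 'I_n => a i.+1) t.

Hypothesis a0 : a 0 = 1.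
Hypothesis newton_q : forall k, (k < n)%N ->
  k.+1%:R * a k.+1 = \sum_(j < k.+1) (-1) ^+ j * q j.+1 * a (k - j).

Let PhiE k : (k <= n)%N -> Phi (E k) = a k.
Proof.
case: k => [|k] kn; rewrite /esym_var; first by rewrite a0 /Phi rmorph1.
by rewrite insubT /= /Phi mmapX mmap1U.
Qed.

Let PhiE_gt k : (n < k)%N -> Phi (E k) = 0.
Proof.
case: k => [|k] kn //; rewrite /esym_var.
by rewrite insubF ?/Phi ?raddf0 //; apply/negbTE; rewrite -leqNgt.
Qed.

Let PhiP k : (k < n)%N -> Phi (P k.+1) = q k.+1.
Proof.
elim/ltn_ind: k => k IH kn.
have NP : k.+1%:R * E k.+1 = \sum_(j < k.+1) (-1) ^+ j * P j.+1 * E (k - j).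
  apply: (@msym_fundamental_un n rat).
  rewrite -/esyms rmorphM rmorph_nat /= EE newton_identity raddf_sum /=.
  by apply: eq_bigr => j _; rewrite !rmorphM rmorphXn rmorphN1 /= EE PE.
have := congr1 Phi NP.
rewrite {1}/Phi rmorphM rmorph_nat /= -/(Phi _) PhiE // newton_q //.
rewrite /Phi raddf_sum /= !big_ord_recr /= !rmorphM rmorphXn rmorphN1 /= subnn.
rewrite -!/(Phi _) (PhiE (leq0n _)) a0 !mulr1.
have -> : \sum_(i < k) Phi ((-1) ^+ i * P i.+1 * E (k - i))
    = \sum_(i < k) (-1) ^+ i * q i.+1 * a (k - i).
  apply: eq_bigr => i _; rewrite /Phi !rmorphM rmorphXn rmorphN1 /= -!/(Phi _).
  rewrite IH ?PhiE // ?(ltn_trans _ kn) //.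
  exact: leq_trans (leq_subr _ _) (ltnW kn).
move/addrI/(congr1 (fun z => (-1) ^+ k * z)).
by rewrite !mulrA -signr_odd -expr2 sqrr_sign !mul1r.
Qed.

(** An identity between polynomials in the p_k and polynomials in the e_k
lifts, by algebraic independence, to the polynomial ring on the e_k. Every
assignment of values to the e_k extends to a ring morphism there, and it takes the
values on the p_k that Newton's identities force. *)
Lemma specialization (I : finType) (pr : pred I) (z : I -> int) (J : finType)
    (A : I -> {set J}) (sz : I -> J -> nat) (ls : seq (seq nat)) (c : seq nat -> rat) :
    (forall i j, pr i -> j \in A i -> 0 < sz i j <= n)%N ->
    \sum_(i | pr i) (z i)%:~R * \prod_(j in A i) psum n (sz i j) =
      \sum_(l <- ls) c l *: epart l n ->
  \sum_(i | pr i) (z i)%:~R * \prod_(j in A i) q (sz i j) =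
    \sum_(l <- ls) c l *: \prod_(k <- l) (if (k <= n)%N then a k else 0).
Proof.
move=> hsz heq.
have : \sum_(i | pr i) (z i)%:~R * \prod_(j in A i) P (sz i j) =
    \sum_(l <- ls) c l *: \prod_(k <- l) E k.
  apply: (@msym_fundamental_un n rat); rewrite -/esyms !raddf_sum /=.
  transitivity (\sum_(i | pr i) (z i)%:~R * \prod_(j in A i) psum n (sz i j)).
    apply: eq_bigr => i _; rewrite rmorphM rmorph_int rmorph_prod /=.
    by congr (_ * _); apply: eq_bigr => j _; rewrite PE.
  rewrite heq; apply: eq_bigr => l _; rewrite comp_mpolyZ; congr (_ *: _).
  by rewrite rmorph_prod /=; apply: eq_bigr => k _; rewrite EE.
move/(congr1 Phi); rewrite /Phi !raddf_sum /= -/Phi.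
set L := (X in X = _ -> _); set L' := (X in _ -> X = _); have -> : L = L'.
  apply: eq_bigr => i hi; rewrite rmorphM rmorph_int rmorph_prod /=.
  congr (_ * _); apply: eq_bigr => j hj; rewrite -/(Phi _).
  by have := hsz _ _ hi hj; case: (sz i j) => // k /andP[_ kn]; rewrite PhiP.
move=> ->; apply: eq_bigr => l _; rewrite mmapZ mulr_algl; congr (_ *: _).
rewrite rmorph_prod /=; apply: eq_bigr => k _; rewrite -/(Phi _).
by case: leqP => kn; [rewrite PhiE | rewrite PhiE_gt].
Qed.

End Specialization.

(** * Inclusion-exclusion over the edges of a rooted tree *)

Section RootedTree.
Variables (V : finType) (r : V) (par : V -> V) (depth : V -> nat).
Hypothesis depth_par : forall v, v != r -> (depth (par v) < depth v)%N.

Definition climb (D : {set V}) v := if v \in D then v else par v.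
(** The nearest ancestor in [D]: as [depth] decreases strictly along [par],
[depth v] steps suffice to reach it when [D] contains the root. *)
Definition anchor (D : {set V}) v := iter (depth v) (climb D) v.
Definition fiber (D : {set V}) d := [set v | anchor D v == d].

Lemma depth_ind (Q : V -> Prop) :
  Q r -> (forall v, v != r -> Q (par v) -> Q v) -> forall v, Q v.
Proof.
move=> Qr Qpar v; have [m] := ubnP (depth v); elim: m v => // m IH v vm.
have [-> //|vr] := eqVneq v r; apply: (Qpar _ vr); apply: IH.
exact: leq_trans (depth_par vr) vm.
Qed.

Section Anchor.
Variable D : {set V}.
Hypothesis rD : r \in D.

Lemma not_anchor_neq v : v \notin D -> v != r.
Proof. by apply: contraNneq => ->. Qed.

Lemma climb_iter_fixed k v : v \in D -> iter k (climb D) v = v.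
Proof. by move=> vD; elim: k => //= k ->; rewrite /climb vD. Qed.

Lemma climb_iter_in k v : (depth v <= k)%N -> iter k (climb D) v \in D.
Proof.
elim: k v => [|k IH] v vk; have [vD|vD] := boolP (v \in D).
- by [].
- by have := depth_par (not_anchor_neq vD); rewrite ltnNge (leq_trans vk).
- by rewrite climb_iter_fixed.
rewrite iterSr {2}/climb (negbTE vD) IH // -ltnS.
exact: leq_trans (depth_par (not_anchor_neq vD)) vk.
Qed.

Lemma anchor_in v : anchor D v \in D.
Proof. exact: climb_iter_in. Qed.

Lemma climb_iter_anchor k v : (depth v <= k)%N -> iter k (climb D) v = anchor D v.
Proof.
move=> /subnK <-; rewrite iterD climb_iter_fixed //; exact: climb_iter_in.
Qed.

Lemma anchor_id v : v \in D -> anchor D v = v.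
Proof. exact: climb_iter_fixed. Qed.

Lemma anchor_par v : v \notin D -> anchor D v = anchor D (par v).
Proof.
move=> vD; have lt := depth_par (not_anchor_neq vD).
rewrite -(climb_iter_anchor (leqnSn (depth v))) iterSr {2}/climb (negbTE vD).
exact/climb_iter_anchor/ltnW.
Qed.

Lemma depth_anchor v : (depth (anchor D v) <= depth v)%N.
Proof.
elim/depth_ind: v => [|v vr IH]; first by rewrite anchor_id.
have [vD|vD] := boolP (v \in D); first by rewrite anchor_id.
by rewrite anchor_par // (leq_trans IH) // ltnW // depth_par.
Qed.

Lemma anchor_par_neq v : v \in D -> v != r -> anchor D (par v) != v.
Proof.
move=> vD vr; apply/eqP => e; have := depth_anchor (par v).
by rewrite e leqNgt depth_par.
Qed.

(** The kept edges go from the vertices outside [D] to their parents, so that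
climbing along them leads from [v] to [anchor D v]. *)
Lemma anchor_unique (X : Type) (f : V -> X) :
  (forall v, v \notin D -> f v = f (par v)) -> forall v, f v = f (anchor D v).
Proof.
move=> fpar; apply: depth_ind => [|v vr IH]; first by rewrite anchor_id.
have [vD|vD] := boolP (v \in D); first by rewrite anchor_id.
by rewrite fpar // anchor_par.
Qed.

Lemma fiber_gt0 d : d \in D -> (0 < #|fiber D d|)%N.
Proof. by move=> dD; apply/card_gt0P; exists d; rewrite inE anchor_id. Qed.

Lemma sum_fiber : (\sum_(d in D) #|fiber D d| = #|V|)%N.
Proof.
rewrite -[RHS]sum1_card [RHS](partition_big (anchor D) (mem D)) /=; last first.
  by move=> v _; exact: anchor_in.
by apply: eq_bigr => d _; rewrite -sum1_card; apply: eq_bigl => v; rewrite inE.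
Qed.

End Anchor.

Section Expansion.
Variables (N : nat) (R : comPzRingType) (x : 'I_N -> R).

(** A coloring that is constant along the kept edges is determined by its
restriction to [D], and the values there are independent. *)
Lemma sum_constant_colorings (D : {set V}) : r \in D ->
  \sum_(k : {ffun V -> 'I_N} | [forall v, (v \notin D) ==> (k v == k (par v))])
     \prod_v x (k v)
  = \prod_(d in D) \sum_j x j ^+ #|fiber D d|.
Proof.
move=> rD; case: N x => [|N'] y.
  rewrite [LHS]big1 => [|k _]; last by case: (k r).
  by rewrite (bigD1 r) //= big_ord0 mul0r.
rewrite (big_distr_big ord0) /=.
rewrite (reindex_onto (fun f : {ffun V -> 'I_N'.+1} => [ffun v => f (anchor D v)])
   (fun k : {ffun V -> 'I_N'.+1} => [ffun v => if v \in D then k v else ord0])) /=.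
  apply: eq_big => [f|f _].
    apply/andP/pfamilyP => [[_ /eqP fE]|[/supportP fD _]].
      split=> // ; apply/supportP => v vD.
      by rewrite -fE ffunE (negbTE vD).
    split.
      apply/forallP => v; apply/implyP => vD; by rewrite !ffunE -anchor_par.
    apply/eqP/ffunP => v; rewrite !ffunE; case: ifP => [vD|/negbT vD].
      by rewrite anchor_id.
    by rewrite fD.
  rewrite (partition_big (anchor D) (mem D)) /=; last by move=> v _; exact: anchor_in.
  apply: eq_bigr => d dD; rewrite -prodr_const; apply: eq_big => v.
    by rewrite inE.
  by move=> /eqP <-; rewrite ffunE.
move=> k /forallP hk; apply/ffunP => v; rewrite !ffunE anchor_in //.
apply/esym; move: v; apply: (@anchor_unique D rD) => v vD.
by have /implyP/(_ vD)/eqP := hk v.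
Qed.

(** The indicator of proper colorings is the product over the edges of
1 - [both ends have the same color]. In the expanded product, [D] collects the
root and the lower ends of the edges where 1 is chosen. *)
Lemma proper_coloring_expansion :
  \sum_(k : {ffun V -> 'I_N} | [forall v, (v != r) ==> (k v != k (par v))])
     \prod_v x (k v)
  = \sum_(D : {set V} | r \in D)
      (-1) ^+ #|~: D| * \prod_(d in D) \sum_j x j ^+ #|fiber D d|.
Proof.
pose G (k : {ffun V -> 'I_N}) v : R := if v == r then 0 else - (k v == k (par v))%:R.
have ind k : \prod_v (1 + G k v) =
    [forall v, (v != r) ==> (k v != k (par v))]%:R.
  have [/forallP hk|] := boolP [forall v, (v != r) ==> (k v != k (par v))].
    rewrite big1 // => v _; rewrite /G; case: eqVneq => vr; first by rewrite addr0.
    by have := hk v; rewrite vr /= => /negbTE ->; rewrite oppr0 addr0.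
  rewrite negb_forall => /existsP[v]; rewrite negb_imply negbK => /andP[vr kv].
  by rewrite (bigD1 v) //= /G (negbTE vr) kv subrr mul0r.
rewrite big_mkcond /=.
transitivity (\sum_(k : {ffun V -> 'I_N}) \sum_(D : {set V} | r \in D)
   (-1) ^+ #|~: D| * ([forall v, (v \notin D) ==> (k v == k (par v))]%:R
     * \prod_v x (k v))).
  apply: eq_bigr => k _; rewrite -mulrb -mulr_natl -ind bigA_distr /=.
  rewrite mulr_suml [RHS]big_mkcond /=; apply: eq_bigr => D _.
  case: ifP => rD; last first.
    by rewrite (bigD1 r) //= rD /G eqxx !mul0r.
  rewrite mulrA; congr (_ * _).
  rewrite (bigID (mem D)) /= big1 ?mul1r; last by move=> v ->.
  rewrite (eq_bigr (fun v => -1 * (k v == k (par v))%:R)); last first.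
    move=> v vD; rewrite (negbTE vD) /G mulN1r ifN //.
    by apply: contraNneq vD => ->.
  rewrite big_split /= prodr_const; congr (_ * _).
    by congr (_ ^+ _); apply: eq_card => v; rewrite !inE.
  have [/forallP hk|] := boolP [forall v, (v \notin D) ==> (k v == k (par v))].
    by rewrite big1 // => v vD; have := hk v; rewrite vD /= => ->.
  rewrite negb_forall => /existsP[v]; rewrite negb_imply => /andP[vD kv].
  by rewrite (bigD1 v) //= (negbTE kv) mul0r.
rewrite exchange_big /=; apply: eq_bigr => D rD.
rewrite -mulr_sumr -sum_constant_colorings // [in RHS]big_mkcond /=.
congr (_ * _); apply: eq_bigr => k _; case: ifP => _; by rewrite ?mul1r ?mul0r.
Qed.

End Expansion.
End RootedTree.

(** * Power sums when only two elementary symmetric functions survive *)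

Section Coef1.
Variables (R : comNzRingType) (I : finType).

Lemma coef1_prod (A : {set I}) (p : I -> {poly R}) :
  (\prod_(i in A) p i)`_1
    = \sum_(i in A) (p i)`_1 * \prod_(j in A :\ i) (p j)`_0.
Proof.
have coef1M (f g : {poly R}) : (f * g)`_1 = f`_1 * g`_0 + f`_0 * g`_1.
  by rewrite coefM big_ord_recl big_ord1 /= subnn addrC.
have coef0_prod (B : {set I}) : (\prod_(i in B) p i)`_0 = \prod_(i in B) (p i)`_0.
  by rewrite -horner_coef0 horner_prod; apply: eq_bigr => i _; rewrite horner_coef0.
have [m] := ubnP #|A|; elim: m A => // m IH A; rewrite ltnS => Am.
have [-> | [i iA]] := set_0Vmem A; first by rewrite !big_set0 coef1.
rewrite (big_setD1 i iA) [RHS](big_setD1 i iA) /= coef1M coef0_prod IH; last first.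
  by rewrite (leq_trans _ Am) // [X in (_ <= X)%N](cardsD1 i) iA.
congr (_ + _); rewrite mulr_sumr; apply: eq_bigr => j /setD1P[ji jA].
rewrite mulrCA; congr (_ * _); rewrite [RHS](big_setD1 i) /=; last first.
  by rewrite !inE eq_sym ji.
by congr (_ * _); apply: eq_bigl => k; rewrite !inE; case: (k == i); case: (k == j).
Qed.

End Coef1.

Lemma coef_signM (R : nzRingType) k (p : {poly R}) i :
  ((-1) ^+ k * p)`_i = (-1) ^+ k * p`_i.
Proof. by rewrite -[(-1) ^+ k]/((- 1%:P) ^+ k) -polyCN -polyC_exp coefCM. Qed.

Section NewtonSequence.
Variable a : nat -> {poly rat}.

(** The values of the power sums p_1, ..., p_m forced by Newton's identities
when each e_k has value [a k]; keeping the whole list makes the course-of-values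
recursion structural. *)
Fixpoint newton_seq m : seq {poly rat} :=
  if m is m'.+1 then
    let qs := newton_seq m' in
    rcons qs ((-1) ^+ m' * (m'.+1%:R * a m'.+1
       - \sum_(j < m') (-1) ^+ j * qs`_j * a (m' - j)))
  else [::].

Definition newton_sum k := (newton_seq k)`_k.-1.

Lemma size_newton_seq m : size (newton_seq m) = m.
Proof. by elim: m => //= m IH; rewrite size_rcons IH. Qed.

Lemma nth_newton_seq m j : (j < m)%N -> (newton_seq m)`_j = newton_sum j.+1.
Proof.
elim: m => // m IH; rewrite ltnS leq_eqVlt => /predU1P[-> // | jm].
by rewrite /= nth_rcons size_newton_seq jm IH.
Qed.

Lemma newton_sumE k :
  newton_sum k.+1 = (-1) ^+ k * (k.+1%:R * a k.+1
    - \sum_(j < k) (-1) ^+ j * newton_sum j.+1 * a (k - j)).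
Proof.
rewrite {1}/newton_sum /= nth_rcons size_newton_seq ltnn eqxx.
congr (_ * (_ - _)); apply: eq_bigr => j _; by rewrite nth_newton_seq.
Qed.

Lemma newton_sumP k : a 0 = 1 ->
  k.+1%:R * a k.+1 = \sum_(j < k.+1) (-1) ^+ j * newton_sum j.+1 * a (k - j).
Proof.
move=> a0; rewrite big_ord_recr /= subnn a0 mulr1 newton_sumE mulrA -expr2.
by rewrite sqrr_sign mul1r addrC subrK.
Qed.

End NewtonSequence.

Section TwoParts.
Variables s m : nat.
Hypotheses (s2 : (1 < s)%N) (m0 : (0 < m)%N).

(** The values of the e_k along the series 1 + z^s + t z^m; the summands are
added so that s and m may coincide. *)
Definition two_parts k : {poly rat} :=
  (k == 0)%:R + (k == s)%:R + (k == m)%:R *: 'X.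

Local Notation q := (newton_sum two_parts).
(** As the sum of (-1)^(k-1) p_k z^k / k is the logarithm of the series, these
coefficients are, up to the factor (-1)^(k-1) k, those of z^k in log (1 + z^s)
and in z^m / (1 + z^s) = z^m - z^(m+s) + z^(m+2s) - ... respectively. *)
Definition pcoef0 k : rat := (q k)`_0.
Definition pcoef1 k : rat := (q k)`_1.

Lemma coef0_two_parts k : (two_parts k)`_0 = (k == 0)%:R + (k == s)%:R.
Proof.
rewrite /two_parts !coefD coefZ coefX mulr0 addr0.
by case: (k == 0); case: (k == s); rewrite ?coef1 ?coef0.
Qed.

Lemma coef1_two_parts k : (two_parts k)`_1 = (k == m)%:R.
Proof.
rewrite /two_parts !coefD coefZ coefX mulr1.
by case: (k == 0); case: (k == s); rewrite ?coef1 ?coef0 ?addr0 ?add0r.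
Qed.

Lemma two_parts0 : two_parts 0 = 1.
Proof.
by rewrite /two_parts eqxx !ltn_eqF ?scale0r ?addr0 // ltnW.
Qed.

Lemma two_parts_ge0 k i : 0 <= (two_parts k)`_i.
Proof.
rewrite /two_parts !coefD coefZ coefX.
by apply: addr_ge0; [apply: addr_ge0|apply: mulr_ge0]; do ?[case: eqP => _];
  rewrite ?coef1 ?coef0 ?ler0n.
Qed.

(* In Newton's recursion only the indices j with k - j = s or k - j = m
   contribute. *)
Let sum_delta k t (F : nat -> rat) : (0 < t)%N ->
  \sum_(j < k) F j * (k - j == t)%N%:R = if (t <= k)%N then F (k - t)%N else 0.
Proof.
move=> t0; case: leqP => tk; last first.
  by rewrite big1 // => j _; rewrite (_ : (k - j == t)%N = false) ?mulr0 //; lia.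
have lt : (k - t < k)%N by lia.
rewrite (bigD1 (Ordinal lt)) //= subKn // eqxx mulr1 big1 ?addr0 // => j.
move=> /eqP jt; rewrite (_ : (k - j == t)%N = false) ?mulr0 //.
by apply/eqP => kj; apply: jt; apply/val_inj => /=; have := ltn_ord j; lia.
Qed.

Let coef_nat k (p : {poly rat}) i : (k%:R * p)`_i = k%:R * p`_i.
Proof. by rewrite mulr_natl coefMn mulr_natl. Qed.

Lemma pcoef0_rec k : pcoef0 k.+1 = (-1) ^+ k * (k.+1%:R * (k.+1 == s)%:R
   - (if (s <= k)%N then (-1) ^+ (k - s) * pcoef0 (k - s).+1 else 0)).
Proof.
rewrite {1}/pcoef0 newton_sumE coef_signM coefB coef_nat coef0_two_parts add0r.
rewrite coef_sum -(@sum_delta k s (fun j => (-1) ^+ j * pcoef0 j.+1)) ?(ltnW s2) //.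
congr (_ * (_ - _)); apply: eq_bigr => j _.
rewrite -mulrA coef_signM coef0M coef0_two_parts -mulrA.
by rewrite subn_eq0 leqNgt ltn_ord add0r.
Qed.

Lemma pcoef1_rec k : pcoef1 k.+1 = (-1) ^+ k * (k.+1%:R * (k.+1 == m)%:R
   - ((if (s <= k)%N then (-1) ^+ (k - s) * pcoef1 (k - s).+1 else 0)
      + (if (m <= k)%N then (-1) ^+ (k - m) * pcoef0 (k - m).+1 else 0))).
Proof.
rewrite {1}/pcoef1 newton_sumE coef_signM coefB coef_nat coef1_two_parts.
rewrite coef_sum -(@sum_delta k s (fun j => (-1) ^+ j * pcoef1 j.+1)) ?(ltnW s2) //.
rewrite -(@sum_delta k m (fun j => (-1) ^+ j * pcoef0 j.+1)) // -big_split /=.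
congr (_ * (_ - _)); apply: eq_bigr => j _.
rewrite -mulrA coef_signM coefM big_ord_recl big_ord1 /= subnn.
rewrite coef0_two_parts coef1_two_parts -!mulrA -mulrDr.
by rewrite subn_eq0 leqNgt ltn_ord add0r addrC.
Qed.

Lemma pcoef0_small k : (k < s)%N -> pcoef0 k = 0.
Proof.
case: k => [|k] ks; first by rewrite /pcoef0 /newton_sum /= coef0.
by rewrite pcoef0_rec ltn_eqF // leqNgt ltnW //= mulr0 subr0 mulr0.
Qed.

Lemma pcoef0_s : pcoef0 s = (-1) ^+ s.-1 * s%:R.
Proof.
case: s s2 pcoef0_rec => // t t1 rec.
by rewrite rec eqxx ltnn subr0 mulr1.
Qed.

Lemma pcoef1_small k : (k < m)%N -> pcoef1 k = 0.
Proof.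
elim/ltn_ind: k => -[|k] IH km; first by rewrite /pcoef1 /newton_sum /= coef0.
rewrite pcoef1_rec ltn_eqF // (leqNgt m) (ltnW km) /= mulr0 addr0.
case: leqP => [sk|_]; last by rewrite subr0 mulr0.
rewrite IH ?mulr0 ?subr0 ?mulr0 //; lia.
Qed.

Lemma pcoef1_m : pcoef1 m = (-1) ^+ m.-1 * m%:R.
Proof.
case: m m0 pcoef1_rec pcoef1_small => // t t1 rec small.
rewrite rec eqxx ltnn addr0 mulr1.
case: leqP => [st|_]; last by rewrite subr0.
rewrite small ?mulr0 ?subr0 //; lia.
Qed.

Lemma pcoef1_m_add_s : pcoef1 (m + s) = (-1) ^+ (m + s) * (m + s)%:R.
Proof.
have -> : (m + s)%N = (m + s).-1.+1 by lia.
rewrite pcoef1_rec (_ : (_ == m) = false); last by lia.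
rewrite !ifT; [|lia..].
have -> : ((m + s).-1 - s = m.-1)%N by lia.
have -> : ((m + s).-1 - m = s.-1)%N by lia.
rewrite (prednK m0) (prednK (ltnW s2)) pcoef1_m pcoef0_s !mulrA -!expr2 !sqrr_sign.
rewrite !mul1r mulr0 sub0r -natrD.
have -> : ((m + s).-1.+1 = m + s)%N by lia.
have {3}-> : (m + s = (m + s).-1.+1)%N by lia.
by rewrite exprS mulN1r mulrN mulNr.
Qed.

End TwoParts.

Section SecondOrder.
Variable m : nat.
Hypothesis m0 : (0 < m)%N.

Local Notation A := (pcoef0 2 m).
Local Notation B := (pcoef1 2 m).

Lemma pcoef0_2_3 : A 3 = 0.
Proof. by rewrite pcoef0_rec //= subnn pcoef0_small // !(mulr0, subr0). Qed.

Lemma pcoef0_2_4 : A 4 = 2%:R.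
Proof. by rewrite pcoef0_rec //= pcoef0_s //= mulr0; ring. Qed.

Lemma pcoef1_2_m_add4 : B (m + 4) = (-1) ^+ m.-1 * (m + 4)%:R.
Proof.
have -> : (m + 4 = (m + 3).+1)%N by lia.
rewrite pcoef1_rec // (_ : (_ == m) = false); last by lia.
rewrite !ifT; [|lia..].
have -> : (m + 3 - 2 = m.+1)%N by lia.
have -> : (m + 3 - m = 3)%N by lia.
rewrite -[m.+2]addn2 pcoef1_m_add_s // pcoef0_2_4.
case: m m0 => // k _ /=; rewrite !natrD !exprD !exprS.
have e2 : (-1) ^+ k * (-1) ^+ k = 1 :> rat by rewrite -expr2 sqrr_sign.
by ring: e2.
Qed.

End SecondOrder.

Local Close Scope ring_scope.

(** * Rooting a tree *)

Section Rooting.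
Variable T : sgraph.

Definition parent_edge (r : T) (par : T -> T) (x y : T) :=
  (x != r) && (par x == y) || (y != r) && (par y == x).

(** The depth is the distance to the root, and the parent is a neighbor at
smaller distance. *)
Lemma exists_parent (r : T) : (forall x : T, connect (@edge T) r x) ->
  exists (par : T -> T) (depth : T -> nat),
    forall v, v != r -> edge (par v) v /\ depth (par v) < depth v.
Proof.
move=> conn.
pose P v k := [exists p : k.-tuple T, path (@edge T) r p && (last r p == v)].
have exP v : exists k, P v k.
  have /connectP[p pp lp] := conn v.
  by exists (size p); apply/existsP; exists (in_tuple p); rewrite pp /= -lp.
pose depth v := ex_minn (exP v).
have ex v : v != r -> exists w, edge w v && (depth w < depth v).
  move=> vr; rewrite {2}/depth; case: ex_minnP => k /existsP[[p /= /eqP pk]].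
  case/andP; case/lastP: p pk => [|p w]; first by move=> _ _ /eqP /= rv; rewrite rv eqxx in vr.
  rewrite size_rcons rcons_path last_rcons => <- /andP[pp lw] /eqP wv _.
  exists (last r p); rewrite -wv lw /= /depth ltnS; case: ex_minnP => j _; apply.
  by apply/existsP; exists (in_tuple p); rewrite pp eqxx.
exists (fun v => odflt r [pick w | edge w v && (depth w < depth v)]), depth => v vr.
case: pickP => [w /andP[] // | none] /=.
by have [w] := ex v vr; rewrite none.
Qed.

(** An edge outside the spanning tree formed by the parents would close a cycle
with the path of that tree joining its ends. *)
Lemma tree_rooting : is_tree T -> exists (r : T) (par : T -> T) (depth : T -> nat),
  (forall v, v != r -> depth (par v) < depth v)
  /\ (forall x y, edge x y = parent_edge r par x y).
Proof.
case=> /card_gt0P[r _] conn acyc.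
have [par [depth pdp]] := exists_parent (conn r).
exists r, par, depth; split=> [v vr | x y]; first by have [] := pdp v vr.
have sub a b : parent_edge r par a b -> edge a b.
  by case/orP=> /andP[nr /eqP <-]; have [] := pdp _ nr; rewrite // edge_sym.
have dlt v : v != r -> depth (par v) < depth v by case/pdp.
have symP : connect_sym (parent_edge r par).
  by apply: sym_connect_sym => a b; rewrite /parent_edge orbC.
have toroot : forall v, connect (parent_edge r par) v r.
  apply: (depth_ind dlt) => // v vr; apply: connect_trans.
  by apply: connect1; rewrite /parent_edge vr eqxx.
apply/idP/idP; last exact: sub.
move=> exy; apply/negPn/negP => nxy.
have /connectP[p0 pp0 lp0] : connect (parent_edge r par) x y.
  by rewrite (connect_trans (toroot x)) // symP.
case: (shortenP pp0) lp0 => p pp up _ lp.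
have : size (x :: p) <= 2.
  apply: acyc; rewrite /ucycle up andbT /= rcons_path -lp edge_sym exy andbT.
  exact: sub_path pp.
case: p pp lp {up} => [|z [|//]] /=; first by move=> _ e; rewrite e edge_irrefl in exy.
by rewrite andbT => pz e _; rewrite e pz in nxy.
Qed.

End Rooting.

(** * Counting edges between vertex sets *)

Section EdgeCounts.
Variable T : sgraph.
Implicit Types X Y C : {set T}.

Definition ecount X Y := \sum_(x in X) \sum_(y in Y) (edge x y : nat).

Lemma ecount_sym X Y : ecount X Y = ecount Y X.
Proof.
rewrite /ecount exchange_big /=; apply: eq_bigr => y _; apply: eq_bigr => x _.
by rewrite edge_sym.
Qed.

Lemma ecount_set0l Y : ecount set0 Y = 0.
Proof. exact: big_set0. Qed.

Lemma ecount_addl X X' Y : [disjoint X & X'] -> ecount (X :|: X') Y = ecount X Y + ecount X' Y.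
Proof.
move=> dX; rewrite /ecount -bigU //=; apply: eq_bigl => x; by rewrite !inE.
Qed.

Lemma ecount_addr X Y Y' : [disjoint Y & Y'] -> ecount X (Y :|: Y') = ecount X Y + ecount X Y'.
Proof. by move=> dY; rewrite ecount_sym ecount_addl // !(ecount_sym X). Qed.

Lemma ecount_gt0P X Y :
  reflect (exists x y, [/\ x \in X, y \in Y & edge x y]) (0 < ecount X Y).
Proof.
rewrite lt0n sum_nat_eq0; apply: (iffP forall_inPn) => [[x xX]|[x [y [xX yY exy]]]].
  rewrite sum_nat_eq0 => /forall_inPn[y yY]; rewrite eqb0 negbK => exy.
  by exists x, y.
exists x => //; rewrite sum_nat_eq0; apply/forall_inPn; exists y => //.
by rewrite exy.
Qed.

(** Exactly one edge leaves [C]: in a tree, [C] is one of the two components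
obtained by deleting that edge. *)
Definition branch C := ecount C (~: C) == 1.

Lemma branchC C : branch (~: C) = branch C.
Proof. by rewrite /branch setCK ecount_sym. Qed.

(** The edges that join distinct fibers are those from the vertices of [D]
other than the root to their parents, and each of them leaves two fibers. *)
Lemma double_crossing (r : T) par depth (D : {set T}) :
  (forall v, v != r -> depth (par v) < depth v) ->
  (forall x y, edge x y = parent_edge r par x y) ->
  r \in D ->
  \sum_(d in D) ecount (fiber par depth D d) (~: fiber par depth D d) = (#|D|.-1).*2.
Proof.
move=> dlt edgeE rD; set anchor := anchor par depth D.
transitivity (\sum_x \sum_y (edge x y && (anchor x != anchor y) : nat)).
  rewrite [RHS](partition_big anchor (mem D)) /=; last by move=> x _; exact: (anchor_in dlt rD).
  apply: eq_bigr => d dD; rewrite /ecount.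
  apply: eq_big => x; first by rewrite inE.
  rewrite inE => /eqP xd; rewrite [LHS]big_mkcond; apply: eq_bigr => y _.
  rewrite !inE -/anchor -xd -/anchor [anchor x == _]eq_sym.
  by case: (anchor y != anchor x); rewrite ?andbT ?andbF.
have cross w : (w != r) && (anchor w != anchor (par w)) = (w \in D :\ r).
  rewrite !inE; have [//|wr] := eqVneq w r; rewrite /anchor /=.
  have [wD|wD] := boolP (w \in D); last by rewrite (anchor_par dlt rD wD) eqxx.
  by rewrite (anchor_id _ _ wD) eq_sym (anchor_par_neq dlt rD wD wr).
have one : \sum_x \sum_y ((x != r) && (par x == y) && (anchor x != anchor y) : nat) = #|D|.-1.
  rewrite (cardsD1 r) rD /= -sum1_card big_mkcond /= [RHS]big_mkcond /=.
  apply: eq_bigr => x _.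
  rewrite (bigD1 (par x)) //= eqxx andbT big1 ?addn0 => [|y].
    by rewrite cross; case: (_ \in _).
  by rewrite eq_sym => /negbTE ->; rewrite andbF.
rewrite -addnn -{1}one -one [X in _ = _ + X]exchange_big -big_split /=.
apply: eq_bigr => x _; rewrite -big_split /=; apply: eq_bigr => y _.
rewrite edgeE /parent_edge [anchor y == _]eq_sym.
have [/andP[xr /eqP xy]|] /= := boolP ((x != r) && (par x == y)).
  have [/andP[yr /eqP yx]|] /= := boolP ((y != r) && (par y == x)).
    by have := dlt _ xr; have := dlt _ yr; rewrite xy yx; lia.
  by rewrite addn0.
by [].
Qed.
End EdgeCounts.

Section Connected.
Variable T : sgraph.
Implicit Types X Y C : {set T}.
Hypothesis conn : forall x y : T, connect (@edge T) x y.

Lemma boundary_gt0 X x y : x \in X -> y \notin X -> 0 < ecount X (~: X).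
Proof.
move=> xX yX; apply/ecount_gt0P.
have /connectP[p pp lp] := conn x y.
elim: p x xX pp lp => [|z p IH] x xX /=; first by move=> _ yx; rewrite yx xX in yX.
case/andP=> xz pz lp; have [zX|zX] := boolP (z \in X); first exact: IH zX pz lp.
by exists x, z; rewrite inE.
Qed.

Lemma ecount1_unique X Y x y x' y' : ecount X Y = 1 -> x \in X -> y \in Y -> edge x y ->
  x' \in X -> y' \in Y -> edge x' y' -> x = x' /\ y = y'.
Proof.
rewrite /ecount => e1 xX yY exy xX' yY' exy'; move: e1.
rewrite (bigD1 x) //= (bigD1 y) //= exy addnAC.
set S := (X in _ + X = _) => e1.
have [xx'|nx] := eqVneq x x'.
  split=> //; apply/eqP/negPn/negP => ny.
  have : 0 < S by rewrite /S (bigD1 y') ?yY' 1?eq_sym //= xx' exy'.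
  by move: e1; lia.
move: e1; rewrite {}/S (bigD1 x') /=; last by rewrite xX' eq_sym.
by rewrite (bigD1 y') //= exy'; lia.
Qed.

(** If no edge joined [X] to the rest of [C], each of these two parts would need
an edge of its own leaving [C]. *)
Lemma branch_connected C X : branch C -> X \subset C -> X != set0 -> X != C ->
  exists x y, [/\ x \in X, y \in C, y \notin X & edge x y].
Proof.
move=> bC sXC /set0Pn[x xX] XC.
have [y yC yX] : exists2 y, y \in C & y \notin X.
  by apply/subsetPn; apply: contra XC => sCX; rewrite eqEsubset sXC.
case: (posnP (ecount X (C :\: X))) => [e0|/ecount_gt0P[a [b [aX /setDP[bC' bX] eab]]]]; last first.
  by exists a, b.
have splitC (Y : {set T}) : Y \subset C -> ~: Y = (C :\: Y) :|: ~: C.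
  by move=> /subsetP sY; apply/setP => z; rewrite !inE; have := sY z;
     case: (z \in Y); case: (z \in C) => //= /(_ isT).
have dis (Y : {set T}) : [disjoint C :\: Y & ~: C].
  by rewrite -setI_eq0; apply/eqP/setP => z; rewrite !inE; case: (z \in C); rewrite ?andbF.
have b1 := boundary_gt0 xX yX.
have yD : y \in C :\: X by rewrite inE yX.
have xD : x \notin C :\: X by rewrite inE xX.
have b2 := boundary_gt0 yD xD.
rewrite splitC // ecount_addr // e0 add0n in b1.
rewrite splitC ?subsetDl // ecount_addr // in b2.
have CDD : C :\: (C :\: X) = X.
  by apply/setP => z; rewrite !inE; have := subsetP sXC z; case: (z \in X); case: (z \in C) => //= /(_ isT).
rewrite CDD ecount_sym e0 add0n in b2.
move: bC; rewrite /branch -{1}(setID C X) (setIidPr sXC) ecount_addl ?dis //.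
  by move/eqP; lia.
by rewrite -setI_eq0; apply/eqP/setP => z; rewrite !inE; case: (z \in X); rewrite ?andbF.
Qed.

End Connected.

(** * Branches and fibers *)

Section Fibers.
Variables (T : sgraph) (r : T) (par : T -> T) (depth : T -> nat).
Hypothesis dlt : forall v, v != r -> depth (par v) < depth v.
Hypothesis edgeE : forall x y : T, edge x y = parent_edge r par x y.
Implicit Types (D C X Y : {set T}).

Local Notation anchor := (anchor par depth).
Local Notation fiber := (fiber par depth).

Lemma edge_par v : v != r -> edge v (par v).
Proof. by move=> vr; rewrite edgeE /parent_edge vr eqxx. Qed.

Lemma crossing D w : r \in D ->
  (w \in D :\ r) = (w != r) && (anchor D w != anchor D (par w)).
Proof.
move=> rD; rewrite !inE; have [//|wr] := eqVneq w r; rewrite /=.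
have [wD|wD] := boolP (w \in D); last by rewrite (anchor_par dlt rD wD) eqxx.
by rewrite (anchor_id _ _ wD) eq_sym (anchor_par_neq dlt rD wD wr).
Qed.

Lemma fiber_self D d : d \in D -> d \in fiber D d.
Proof. by move=> dD; rewrite inE anchor_id. Qed.

Lemma fiber_disjoint D d d' : d != d' -> [disjoint fiber D d & fiber D d'].
Proof.
move=> dd; rewrite -setI_eq0; apply/eqP/setP => x; rewrite !inE.
by apply/andP => -[/eqP-> /eqP/esym e]; rewrite e eqxx in dd.
Qed.

Lemma fiber_setC1 D c d : r \in D -> D :\ c = [set d] -> ~: fiber D c = fiber D d.
Proof.
move=> rD Dc; apply/setP => x; rewrite !inE.
have := anchor_in dlt rD x; move: (anchor D x) => t tD.
have /setP/(_ t) := Dc; rewrite !inE tD andbT => ->; by [].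
Qed.

Lemma fiber_setC2 D c d1 d2 : r \in D -> D :\ c = [set d1; d2] ->
  ~: fiber D c = fiber D d1 :|: fiber D d2.
Proof.
move=> rD Dc; apply/setP => x; rewrite !inE.
have := anchor_in dlt rD x; move: (anchor D x) => t tD.
have /setP/(_ t) := Dc; rewrite !inE tD andbT => ->; by [].
Qed.

(** The fibers other than that of [c] determine every edge joining distinct
fibers, since such an edge leaves at least one of them. *)
Lemma fiber_family_inj D D' c c' : r \in D -> r \in D' -> c \in D -> c' \in D' ->
  [set fiber D d | d in D :\ c] = [set fiber D' d | d in D' :\ c'] -> (D, c) = (D', c').
Proof.
move=> rD rD' cD cD' eqf.
have sep D0 c0 w : r \in D0 -> c0 \in D0 -> (w \in D0 :\ r) = (w != r) &&
    [exists C, (C \in [set fiber D0 d | d in D0 :\ c0]) && ((w \in C) != (par w \in C))].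
  move=> rD0 cD0; rewrite crossing //; congr (_ && _).
  apply/idP/existsP => [tw | [_ /andP[/imsetP[d dD ->]]]]; last first.
    by rewrite !inE; apply: contra => /eqP ->.
  have [tc|tc] := eqVneq (anchor D0 w) c0.
    exists (fiber D0 (anchor D0 (par w))); rewrite !inE eqxx (negbTE tw) andbT.
    by apply/imsetP; exists (anchor D0 (par w)); rewrite // !inE (anchor_in dlt) // andbT -tc eq_sym.
  exists (fiber D0 (anchor D0 w)); rewrite !inE eqxx eq_sym eqb_id eq_sym tw andbT.
  by apply/imsetP; exists (anchor D0 w); rewrite // !inE tc (anchor_in dlt).
have DD : D = D'.
  apply/setP => w; have [->|wr] := eqVneq w r; first by rewrite rD rD'.
  have := sep D c w rD cD; have := sep D' c' w rD' cD'.
  by rewrite eqf !inE wr /= => -> ->.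
move: rD' cD' eqf; rewrite -{}DD => _ cD' eqf; congr (_, _).
apply/eqP/negPn/negP => cc.
have : fiber D c \in [set fiber D d | d in D :\ c'].
  by apply/imsetP; exists c; rewrite // !inE cc.
rewrite -eqf => /imsetP[d]; rewrite !inE => /andP[dc dD] fcd.
by have := fiber_self cD; rewrite fcd inE anchor_id // eq_sym (negbTE dc).
Qed.

Lemma branch_fiber D c : r \in D -> c \in D -> #|D| = 2 -> branch (fiber D c).
Proof.
move=> rD cD D2; have := double_crossing dlt edgeE rD.
have /eqP/cards1P[d Dc] : #|D :\ c| = 1 by have := cardsD1 c D; rewrite cD D2; lia.
have dD : d \in D by have := set11 d; rewrite -Dc => /setD1P[].
rewrite (big_setD1 c) //= Dc big_set1 -(fiber_setC1 rD Dc) setCK ecount_sym D2 /=.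
by rewrite /branch ecount_sym; lia.
Qed.

(** If [v] is the lower end of the edge leaving [C], membership in [C] is
constant along all other edges, hence constant on the two fibers of the set made
of the root and [v]. *)
Lemma fiber_of_branch C : branch C ->
  exists D c, [/\ r \in D, c \in D, #|D| = 2 & fiber D c = C].
Proof.
move/eqP=> bC; have /ecount_gt0P[x [y [xC yC exy]]] : 0 < ecount C (~: C) by rewrite bC.
have uniqC a b : a \in C -> b \notin C -> edge a b -> a = x /\ b = y.
  move=> aC bC' eab; have bCC : b \in ~: C by rewrite inE.
  by have [-> ->] := ecount1_unique bC xC yC exy aC bCC eab.
rewrite inE in yC.
have crossC v : v != r -> (v \in C) != (par v \in C) ->
    (v == x) && (par v == y) || (v == y) && (par v == x).
  move=> vr; have ev := edge_par vr.
  have [vC|vC] := boolP (v \in C); have [pC|pC] := boolP (par v \in C) => // _.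
    by have [<- <-] := uniqC _ _ vC pC ev; rewrite !eqxx.
  rewrite edge_sym in ev.
  by have [<- <-] := uniqC _ _ pC vC ev; rewrite !eqxx orbT.
have [v [vr vC]] : exists v, v != r /\ (v \in C) != (par v \in C).
  move: exy; rewrite edgeE => /orP[] /andP[nr /eqP e].
    by exists x; rewrite nr e xC (negbTE yC).
  by exists y; rewrite nr e xC (negbTE yC).
pose D := [set r; v].
have rD : r \in D by rewrite !inE eqxx.
have vD : v \in D by rewrite !inE eqxx orbT.
have topC w : (w \in C) = (anchor D w \in C).
  apply: (anchor_unique dlt rD (f := fun w => w \in C)) => u.
  rewrite !inE negb_or => /andP[ur uv]; apply/eqP/negPn/negP => uC.
  have du := dlt ur; have dv := dlt vr.
  have [/andP[/eqP eu /eqP epu]|/andP[/eqP eu /eqP epu]] := orP (crossC _ ur uC);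
  have [/andP[/eqP ev /eqP epv]|/andP[/eqP ev /eqP epv]] := orP (crossC _ vr vC).
  - by rewrite eu ev eqxx in uv.
  - by rewrite epu eu in du; rewrite epv ev ltnNge ltnW in dv.
  - by rewrite epu eu in du; rewrite epv ev ltnNge ltnW in dv.
  by rewrite eu ev eqxx in uv.
have rv : (r \in C) = ~~ (v \in C).
  have : anchor D (par v) == r.
    have := anchor_par_neq dlt rD vD vr; have := anchor_in dlt rD (par v).
    by rewrite !inE => /orP[// | ->].
  by move/eqP; have := topC (par v) => + e; rewrite e => <-; move: vC; case: (v \in C); case: (par v \in C).
exists D, (if r \in C then r else v); split=> //; first by case: ifP.
  by rewrite cards2 eq_sym vr.
apply/setP => w; rewrite inE (topC w).
have := anchor_in dlt rD w; rewrite {1}/D in_set2 => /orP[] /eqP ->.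
  by case: ifP => rC; rewrite ?eqxx // eq_sym (negbTE vr).
by move: rv; case: (v \in C) => -> /=; rewrite ?eqxx // (negbTE vr).
Qed.

Lemma fiber2_edge D d : r \in D -> d \in D -> #|fiber D d| = 2 ->
  exists w, [/\ fiber D d = [set d; w], d != w & edge d w].
Proof.
move=> rD dD f2; have := cardsD1 d (fiber D d); rewrite fiber_self // f2 => /eqP.
rewrite eqSS eq_sym => /cards1P[w fw].
have : w \in fiber D d :\ d by rewrite fw set11.
rewrite !inE => /andP[wd /eqP tw].
have wD : w \notin D by apply: contra wd => wD; rewrite -tw anchor_id.
have wr := not_anchor_neq rD wD.
have : par w \in fiber D d by rewrite inE -(anchor_par dlt rD wD) tw.
rewrite -(setD1K (fiber_self dD)) fw !inE => /orP[/eqP pw|/eqP pw]; last first.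
  by have := dlt wr; rewrite pw ltnn.
exists w; rewrite eq_sym wd; split=> //.
by rewrite edge_sym -pw edge_par.
Qed.

Definition branches k := [set C : {set T} | branch C & #|C| == k].

Definition two_fibers k := [set x : {set T} * T |
  [&& r \in x.1, x.2 \in x.1, #|x.1| == 2 & #|~: fiber x.1 x.2| == k]].

(** Pairs of deleted edges, encoded by [D], with a distinguished component, that
of [c], such that the two other components have size 2. Distinguishing a component
matters when n = 6, where all three have size 2. *)
Definition two_dominoes := [set x : {set T} * T |
  [&& r \in x.1, x.2 \in x.1, #|x.1| == 3 &
      [forall d in x.1 :\ x.2, #|fiber x.1 d| == 2]]].

Lemma card_two_fibers k : #|two_fibers k| = #|branches k|.
Proof.
pose other (x : {set T} * T) := ~: fiber x.1 x.2.
rewrite -(card_in_imset (f := other)).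
  apply: eq_card => C; rewrite inE; apply/imsetP/andP => [[[D c]]|[bC /eqP Ck]].
    rewrite inE /= => /and4P[rD cD /eqP D2 /eqP <-] ->.
    by rewrite /other /= branchC branch_fiber.
  have bC' : branch (~: C) by rewrite branchC.
  have [D [c [rD cD D2 fC]]] := fiber_of_branch bC'.
  by exists (D, c); rewrite ?inE /= /other /= ?rD ?cD ?D2 ?fC ?setCK ?Ck ?eqxx.
move=> [D c] [D' c']; rewrite !inE /= => /and4P[rD cD /eqP D2 _] /and4P[rD' cD' /eqP D2' _] oeq.
have fam D0 c0 : r \in D0 -> c0 \in D0 -> #|D0| = 2 ->
    [set fiber D0 d | d in D0 :\ c0] = [set other (D0, c0)].
  move=> rD0 cD0 D02.
  have /eqP/cards1P[d Dc] : #|D0 :\ c0| = 1 by have := cardsD1 c0 D0; rewrite cD0 D02; lia.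
  by rewrite Dc imset_set1 /other /= (fiber_setC1 rD0 Dc).
by apply: fiber_family_inj => //; rewrite !fam // oeq.
Qed.

Lemma two_dominoes_inj :
  {in two_dominoes &, injective (fun x : {set T} * T => [set fiber x.1 d | d in x.1 :\ x.2])}.
Proof.
move=> [D c] [D' c']; rewrite !inE /= => /and4P[rD cD _ _] /and4P[rD' cD' _ _].
exact: fiber_family_inj.
Qed.

Hypothesis conn : forall x y : T, connect (@edge T) x y.

Definition domino C := exists a b, [/\ C = [set a; b], a != b & edge a b].

(** The three components are joined by exactly two edges and none of them is
isolated, so one of them is in the middle. If it is the distinguished one, both
dominoes are branches; otherwise the dominoes are joined by an edge, and the
outer one is a branch. *)
Lemma two_dominoesP D c : (D, c) \in two_dominoes -> exists C1 C2,
  [/\ [set fiber D d | d in D :\ c] = [set C1; C2],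
      [disjoint C1 & C2], domino C1, domino C2 &
   (branch C1 /\ branch C2) \/ [/\ branch (C1 :|: C2), branch C1 & ecount C1 C2 = 1]].
Proof.
rewrite inE /= => /and4P[rD cD /eqP D3 /forall_inP f2].
have /eqP/cards2P[d1 [d2 [d12 Dc]]] : #|D :\ c| = 2 by have := cardsD1 c D; rewrite cD D3; lia.
have fc := fiber_setC2 rD Dc.
have [c1 d1D] : c != d1 /\ d1 \in D.
  by have : d1 \in D :\ c by [rewrite Dc !inE eqxx]; rewrite !inE eq_sym => /andP.
have [c2 d2D] : c != d2 /\ d2 \in D.
  by have : d2 \in D :\ c by [rewrite Dc !inE eqxx orbT]; rewrite !inE eq_sym => /andP.
have dom d : d \in D -> c != d -> domino (fiber D d).
  move=> dD cd; have /f2/eqP fd2 : d \in D :\ c by rewrite !inE eq_sym cd.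
  by have [w [-> ? ?]] := fiber2_edge rD dD fd2; exists d, w.
have dis0 d : c != d -> [disjoint fiber D c & fiber D d] by exact: fiber_disjoint.
have dis12 := fiber_disjoint D d12.
have f1 : ~: fiber D d1 = fiber D c :|: fiber D d2.
  apply: fiber_setC2 => //; apply/setP => z; have /setP/(_ z) := Dc; rewrite !inE.
  have [->|zc] := eqVneq z c; first by rewrite cD c1.
  have [->|zd] //= := eqVneq z d1; by move=> _; apply/esym/negbTE.
have f2' : ~: fiber D d2 = fiber D c :|: fiber D d1.
  apply: fiber_setC2 => //; apply/setP => z; have /setP/(_ z) := Dc; rewrite !inE.
  have [->|zc] := eqVneq z c; first by rewrite cD c2.
  have [->|zd] //= := eqVneq z d2; last by rewrite orbF.
  by move=> _; apply/esym/negbTE; rewrite eq_sym.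
have bd d d' : d \in D -> d' \in D -> d != d' -> 0 < ecount (fiber D d) (~: fiber D d).
  move=> dD dD' dd; apply: (boundary_gt0 conn (fiber_self dD) (y := d')).
  by rewrite inE anchor_id // eq_sym.
have := bd _ _ cD d1D c1; have := bd _ _ d1D d2D d12.
have := bd _ _ d2D cD; rewrite eq_sym => /(_ c2).
have := double_crossing dlt edgeE rD; rewrite D3 (big_setD1 c) //= Dc.
rewrite big_setU1 ?inE //= big_set1.
have bU : branch (fiber D d1 :|: fiber D d2) = (ecount (fiber D c) (~: fiber D c) == 1).
  by rewrite -fc branchC.
have b1 : branch (fiber D d1) = (ecount (fiber D d1) (~: fiber D d1) == 1) by [].
have b2 : branch (fiber D d2) = (ecount (fiber D d2) (~: fiber D d2) == 1) by [].
move: bU b1 b2; rewrite fc f1 f2' !ecount_addr ?dis0 //.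
rewrite ![ecount _ (fiber D c)]ecount_sym [ecount (fiber D d2) (fiber D d1)]ecount_sym.
set e12 := ecount (fiber D d1) (fiber D d2); set e1 := ecount (fiber D c) (fiber D d1).
set e2 := ecount (fiber D c) (fiber D d2) => bU b1 b2 tot p2 p1 p0.
have fam : [set fiber D d | d in [set d1; d2]] = [set fiber D d1; fiber D d2].
  by rewrite imsetU1 imset_set1.
have dom1 := dom _ d1D c1; have dom2 := dom _ d2D c2.
have [[m12 [m1 m2]]|[[m12 [m1 m2]]|[m12 [m1 m2]]]] : (e12 = 0 /\ e1 = 1 /\ e2 = 1)
    \/ (e12 = 1 /\ e1 = 0 /\ e2 = 1) \/ (e12 = 1 /\ e1 = 1 /\ e2 = 0).
  by move: tot p2 p1 p0; clear; lia.
- exists (fiber D d1), (fiber D d2); split; rewrite ?fam //.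
  by left; rewrite b1 b2 m12 m1 m2.
- exists (fiber D d1), (fiber D d2); split; rewrite ?fam //.
  by right; rewrite bU b1 m12 m1 m2.
exists (fiber D d2), (fiber D d1); split; rewrite ?fam //.
- by rewrite setUC.
- by rewrite disjoint_sym.
by right; rewrite setUC bU b2 m12 m1 m2 ecount_sym.
Qed.

End Fibers.

Local Open Scope ring_scope.

(** * Two necessary conditions for e-positivity *)

Section Coefficients.
Variables (T : sgraph) (r : T) (par : T -> T) (depth : T -> nat).
Hypothesis dlt : forall v, v != r -> (depth (par v) < depth v)%N.
Hypothesis edgeE : forall x y : T, edge x y = parent_edge r par x y.
Implicit Types (D C : {set T}).

Local Notation fiber := (fiber par depth).
Local Notation n := #|T|.

Lemma proper_coloring_parent N (k : {ffun T -> 'I_N}) :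
  proper_coloring k = [forall v, (v != r) ==> (k v != k (par v))].
Proof.
apply/forallP/forallP => [h v | h x].
  apply/implyP => vr; have /forallP/(_ (par v))/implyP := h v; apply.
  exact: edge_par edgeE _ vr.
apply/forallP => y; apply/implyP; rewrite edgeE => /orP[]/andP[nr /eqP <-].
  by have := h x; rewrite nr.
by have := h y; rewrite nr /= eq_sym.
Qed.

Lemma chromsym_psum N : chromsym T N = \sum_(D : {set T} | r \in D)
  ((-1) ^+ #|~: D|)%:~R * \prod_(d in D) psum N #|fiber D d|.
Proof.
rewrite /chromsym (eq_bigl _ _ (@proper_coloring_parent N)).
rewrite (proper_coloring_expansion dlt (fun j : 'I_N => 'X_j : {mpoly rat[N]})); apply: eq_bigr => D _.
by rewrite rmorphXn rmorphN1.
Qed.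

Lemma e_positive_coef (a : nat -> {poly rat}) i :
  e_positive T -> a 0%N = 1 -> (forall k j, 0 <= (a k)`_j) ->
  0 <= (\sum_(D : {set T} | r \in D)
    (-1) ^+ #|~: D| * \prod_(d in D) newton_sum a #|fiber D d|)`_i.
Proof.
move=> [c [[_ cE] c_ge0]] a0 a_ge0.
have sz D d : r \in D -> d \in D -> (0 < #|fiber D d| <= n)%N.
  by move=> rD dD; rewrite (fiber_gt0 _ _ dD) max_card.
have -> : \sum_(D : {set T} | r \in D)
    (-1) ^+ #|~: D| * \prod_(d in D) newton_sum a #|fiber D d|
  = \sum_(l <- finsupp c) c l *: \prod_(k <- l) (if (k <= n)%N then a k else 0).
  rewrite -(@specialization n {poly rat} a (newton_sum a) a0
    (fun k _ => @newton_sumP a k a0) {set T} (fun D => r \in D)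
    (fun D => (-1) ^+ #|~: D|) T id (fun D d => #|fiber D d|) (finsupp c) c sz).
    by apply: eq_bigr => D _; rewrite rmorphXn rmorphN1.
  by rewrite -chromsym_psum cE.
rewrite coef_sum.
apply: sumr_ge0 => l _; rewrite coefZ; apply: mulr_ge0; first exact: c_ge0.
elim: l i => [|k l IH] i; first by rewrite big_nil coef1; case: eqP.
rewrite big_cons coefM; apply: sumr_ge0 => j _; apply: mulr_ge0 => //.
by case: ifP => _; rewrite ?coef0.
Qed.

Section Weights.
Variables s m : nat.
Hypotheses (s2 : (1 < s)%N) (m0 : (0 < m)%N).

(** The contribution to the coefficient of t of the deletion of the edges
encoded by [x.1], when the factor t is taken from the fiber of [x.2]. *)
Definition weight (x : {set T} * T) : rat :=
  (-1) ^+ #|~: x.1| * (pcoef1 s m #|fiber x.1 x.2| *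
    \prod_(d in x.1 :\ x.2) pcoef0 s m #|fiber x.1 d|).

Lemma e_positive_sum_weight : e_positive T ->
  0 <= \sum_(x : {set T} * T | (r \in x.1) && (x.2 \in x.1)) weight x.
Proof.
move=> eT; have := e_positive_coef 1 eT (two_parts0 s2 m0) (@two_parts_ge0 s m).
rewrite coef_sum.
rewrite -(pair_big_dep (fun D => r \in D) (fun D c => c \in D) (fun D c => weight (D, c))) /=.
congr (0 <= _); apply: eq_bigr => D rD.
rewrite coef_signM coef1_prod mulr_sumr; exact: eq_bigr.
Qed.

Lemma sum_other_fibers D c : r \in D -> c \in D ->
  (#|fiber D c| + \sum_(d in D :\ c) #|fiber D d| = n)%N.
Proof. by move=> rD cD; rewrite -(sum_fiber dlt rD) [RHS](big_setD1 c). Qed.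

(** Either a fiber other than that of [c] has fewer than s vertices, or all of
them have at least s and too few vertices remain for the fiber of [c]. *)
Lemma weight0 D c : r \in D -> c \in D ->
  (n < m + s * #|D|.-1)%N -> weight (D, c) = 0.
Proof.
move=> rD cD nlt; rewrite /weight /=.
have [/existsP[d /andP[dD ds]]|] := boolP [exists d, (d \in D :\ c) && (#|fiber D d| < s)%N].
  by rewrite (big_setD1 d dD) /= pcoef0_small // mul0r !mulr0.
rewrite negb_exists => /forallP big; rewrite pcoef1_small ?mul0r ?mulr0 //.
have := sum_other_fibers rD cD.
have : (s * #|D|.-1 <= \sum_(d in D :\ c) #|fiber D d|)%N.
  rewrite (_ : #|D|.-1 = #|D :\ c|); last by have := cardsD1 c D; rewrite cD; lia.
  rewrite mulnC -sum_nat_const; apply: leq_sum => d dD.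
  by have := big d; rewrite dD -leqNgt.
lia.
Qed.

Lemma card_setC_sub D k : #|D| = k -> #|~: D| = (n - k)%N.
Proof. by move=> <-; rewrite cardsCs setCK. Qed.

Lemma weight_one D c : r \in D -> c \in D -> #|D| = 1%N ->
  weight (D, c) = (-1) ^+ (n - 1) * pcoef1 s m n.
Proof.
move=> rD cD D1; rewrite /weight /=.
have Dc : D :\ c = set0 by apply/eqP; rewrite -cards_eq0; have := cardsD1 c D; rewrite cD D1; lia.
have := sum_other_fibers rD cD.
by rewrite Dc !big_set0 addn0 mulr1 => ->; rewrite (card_setC_sub D1).
Qed.

Lemma weight_two D c : r \in D -> c \in D -> #|D| = 2%N ->
  weight (D, c) = (-1) ^+ (n - 2) * (pcoef1 s m (n - #|~: fiber D c|) * pcoef0 s m #|~: fiber D c|).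
Proof.
move=> rD cD D2; rewrite /weight /=.
have /eqP/cards1P[d Dc] : #|D :\ c| = 1%N by have := cardsD1 c D; rewrite cD D2; lia.
rewrite (card_setC_sub D2) Dc big_set1 (fiber_setC1 dlt rD Dc).
have := sum_other_fibers rD cD; rewrite Dc big_set1 => <-.
by rewrite addnK.
Qed.

Lemma card_root_only :
  #|[set x : {set T} * T | [&& r \in x.1, x.2 \in x.1 & #|x.1| == 1%N]]| = 1%N.
Proof.
rewrite (_ : [set x | _] = [set ([set r], r)]) ?cards1 //.
apply/setP => -[D c]; rewrite !inE /= xpair_eqE.
apply/and3P/andP => [[rD cD /cards1P[x Dx]]|[/eqP-> /eqP->]]; last first.
  by rewrite cards1 !inE eqxx.
by move: rD cD; rewrite Dx !inE => /eqP-> /eqP->.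
Qed.

End Weights.

(** With at most 4 vertices outside the fiber of [c], these split as nothing, as
one fiber of size 2 or 4 (the constant terms for sizes 1 and 3 vanish), or as two
fibers of size 2. *)
Lemma weight_second_order D c (m := (n - 4)%N) : (4 < n)%N -> r \in D -> c \in D ->
  weight 2 m (D, c) = n%:R * (#|D| == 1%N)%:R
  - (2 * (n - 2))%:R * ((D, c) \in two_fibers r par depth 2)%:R
  - (2 * (n - 4))%:R * ((D, c) \in two_fibers r par depth 4)%:R
  + (4 * (n - 4))%:R * ((D, c) \in two_dominoes r par depth)%:R.
Proof.
move=> n5 rD cD; have m0 : (0 < m)%N by rewrite subn_gt0.
have nE : n = (m + 4)%N by rewrite subnK // ltnW.
have sgn k : (-1) ^+ (2 * k) = 1 :> rat by rewrite exprM sqrrN expr1n.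
have D0 : (0 < #|D|)%N by apply/card_gt0P; exists r.
rewrite !inE /= rD cD /=.
have [D1|D1] := eqVneq #|D| 1%N.
  rewrite weight_one // D1 /= {2}nE pcoef1_2_m_add4 // -nE mulrA -exprD.
  by have -> : (n - 1 + m.-1 = 2 * m.+1)%N; [lia | rewrite sgn; ring].
have [D2|D2] := eqVneq #|D| 2%N.
  rewrite weight_two // D2 /=; move: #|~: _| => k.
  have [->|k2] := eqVneq k 2%N.
    rewrite pcoef0_s // (_ : (n - 2 = m + 2)%N) ?pcoef1_m_add_s //; last by lia.
    by rewrite !mulrA -exprD addnn -mul2n sgn /=; ring.
  have [->|k4] := eqVneq k 4%N.
    rewrite pcoef0_2_4 //; have -> := pcoef1_m (isT : 1 < 2)%N m0; rewrite !mulrA -exprD.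
    have -> : (n - 2 + m.-1 = 2 * m + 1)%N by lia.
    by rewrite exprD sgn natrM /=; ring.
  suff -> : pcoef1 2 m (n - k) * pcoef0 2 m k = 0 by rewrite !(mulr0, subr0, addr0).
  case: k k2 k4 => [|[|[|[|[|k]]]]] // _ _.
  - by rewrite [pcoef0 _ _ 0]pcoef0_small ?mulr0.
  - by rewrite [pcoef0 _ _ 1]pcoef0_small ?mulr0.
  - by have -> := pcoef0_2_3 m0; rewrite mulr0.
  by rewrite pcoef1_small ?mul0r //; lia.
rewrite !(mulr0, subr0, add0r).
have [D3|D3] := eqVneq #|D| 3%N; last first.
  by rewrite /= mulr0; apply: weight0 => //; lia.
rewrite /weight /= (card_setC_sub D3).
have /eqP/cards2P[d1 [d2 [d12 Dc]]] : #|D :\ c| = 2%N by have := cardsD1 c D; rewrite cD D3; lia.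
have := sum_other_fibers rD cD; rewrite Dc !big_setU1 ?inE //= !big_set1.
have -> : [forall d in [set d1; d2], #|fiber D d| == 2%N]
    = (#|fiber D d1| == 2%N) && (#|fiber D d2| == 2%N).
  apply/forall_inP/andP => [h|[h1 h2] d]; first by rewrite !h ?inE ?eqxx ?orbT.
  by rewrite !inE => /orP[]/eqP->.
move: #|fiber D c| #|fiber D d1| #|fiber D d2| => k0 k1 k2 sumk; rewrite nE in sumk.
have [k1s|k1s] := ltnP k1 2; first by rewrite pcoef0_small // (ltn_eqF k1s) !(mulr0, mul0r).
have [k2s|k2s] := ltnP k2 2; first by rewrite [pcoef0 _ _ k2]pcoef0_small // (ltn_eqF k2s) andbF !(mulr0, mul0r).
have [/andP[/eqP k12 /eqP k22]|kne] /= := boolP ((k1 == 2%N) && (k2 == 2%N)).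
  have -> : k0 = m by lia.
  rewrite k12 k22.
  rewrite pcoef0_s // pcoef1_m // !mulrA -exprD.
  have -> : (n - 3 + m.-1 = 2 * m)%N by lia.
  by rewrite sgn natrM; ring.
by rewrite mulr0 pcoef1_small ?mul0r ?mulr0 //; lia.
Qed.

(** For m = n - s the coefficient of t is -n plus contributions of the branches
of size s; this is the coefficient of e_(n-s) e_s in the e-expansion, up to a
positive factor. *)
Lemma branch_of_size s : (1 < s < n)%N -> e_positive T -> (0 < #|branches T s|)%N.
Proof.
move=> /andP[s2 sn] eT; rewrite lt0n; apply/negP => /eqP br0.
pose m := (n - s)%N; have m0 : (0 < m)%N by rewrite subn_gt0.
have nE : n = (m + s)%N by rewrite subnK // ltnW.
have := e_positive_sum_weight s2 m0 eT.
have F0 D c : r \in D -> c \in D -> #|D| = 2%N -> #|~: fiber D c| != s.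
  move=> rD cD D2; have /eqP := card_two_fibers dlt edgeE s.
  rewrite br0 cards_eq0 => /eqP/setP/(_ (D, c)).
  by rewrite !inE /= rD cD D2 eqxx /= => ->.
rewrite (eq_bigr (fun x : {set T} * T => - n%:R * (#|x.1| == 1%N)%:R)); last first.
  move=> [D c] /= /andP[rD cD].
  have [D1|D1] := eqVneq #|D| 1%N.
    rewrite weight_one // {2}nE pcoef1_m_add_s // -nE mulr1 mulrA -exprD.
    have n0 : (0 < n)%N by rewrite (leq_trans _ sn).
    have -> : (n - 1 + n = (n - 1) * 2 + 1)%N by lia.
    by rewrite exprD exprM sqrr_sign expr1 mul1r mulN1r.
  rewrite mulr0; have D0 : (0 < #|D|)%N by apply/card_gt0P; exists r.
  have [D2|D2] := eqVneq #|D| 2%N; last by apply: weight0 => //; rewrite {1}nE; nia.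
  rewrite weight_two //; have := F0 _ _ rD cD D2; move: #|~: _| => k ks.
  case: (ltnP k s) => [ks'|sk]; first by rewrite pcoef0_small // !mulr0.
  by rewrite pcoef1_small ?mul0r ?mulr0 //; lia.
rewrite -mulr_sumr (_ : \sum_(_ | _) _ = 1); last first.
  rewrite -natr_sum -[RHS]/(1%:R) -[in RHS]card_root_only -sum1_card; congr _%:R.
  by rewrite [RHS]big_mkcond [LHS]big_mkcond; apply: eq_bigr => x _; rewrite !inE;
    case: (r \in x.1); case: (x.2 \in x.1); case: (_ == _).
rewrite mulr1 oppr_ge0 lern0 => /eqP n0; move: sn; by rewrite n0.
Qed.

(** For s = 2 and m = n - 4 the coefficient of t is, up to a positive factor,
the coefficient of e_(n-4) e_2 e_2; the difference of the two sides is its value. *)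
Lemma branches_vs_dominoes : (4 < n)%N -> e_positive T ->
  (2 * (n - 2) * #|branches T 2| + 2 * (n - 4) * #|branches T 4|
    <= n + 4 * (n - 4) * #|two_dominoes r par depth|)%N.
Proof.
move=> n5 eT; pose m := (n - 4)%N; have m0 : (0 < m)%N by rewrite subn_gt0.
have nE : n = (m + 4)%N by rewrite subnK // ltnW.
have := e_positive_sum_weight (isT : 1 < 2)%N m0 eT.
rewrite (eq_bigr (fun x : {set T} * T => n%:R * (#|x.1| == 1%N)%:R
  - (2 * (n - 2))%:R * (x \in two_fibers r par depth 2)%:R
  - (2 * (n - 4))%:R * (x \in two_fibers r par depth 4)%:R
  + (4 * (n - 4))%:R * (x \in two_dominoes r par depth)%:R)); last first.
  by move=> [D c] /= /andP[rD cD]; rewrite weight_second_order.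
have cnt (S : {set {set T} * T}) : (forall x, x \in S -> (r \in x.1) && (x.2 \in x.1)) ->
    \sum_(x : {set T} * T | (r \in x.1) && (x.2 \in x.1)) (x \in S)%:R = #|S|%:R :> rat.
  move=> sub; rewrite -natr_sum -sum1_card; congr _%:R.
  rewrite [RHS]big_mkcond [LHS]big_mkcond; apply: eq_bigr => x _.
  by have := sub x; case: (x \in S) => [->|] //; case: ifP.
rewrite big_split !sumrB /= -!mulr_sumr.
rewrite [X in _ * X - _ - _ + _](_ : _ = 1); last first.
  rewrite -[RHS]/(1%:R) -[in RHS]card_root_only -cnt => [|x].
    by apply: eq_bigr => x /andP[rx cx]; rewrite inE rx cx.
  by rewrite inE => /and3P[-> ->].
rewrite !cnt; try by [move=> x; rewrite inE => /and4P[-> ->]].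
rewrite !card_two_fibers // mulr1 -!natrM.
set a := (_ * _ * #|branches T 2|)%N; set b := (_ * _ * #|branches T 4|)%N.
rewrite -(ler_nat rat) !natrD; lra.
Qed.

End Coefficients.

Local Close Scope ring_scope.

(** * Branches and pendent subgraphs *)

Lemma isomorphic_nth k (e : rel 'I_k) es ei (G : sgraph) (X : eqType)
    (adj : rel X) (g : G -> X) (s : seq X) (x0 : X) :
  injective g -> size s = k -> uniq s -> #|G| = k -> (forall x, g x \in s) ->
  (forall x y, edge x y = adj (g x) (g y)) ->
  (forall i j : 'I_k, (i < j)%N -> adj (nth x0 s i) (nth x0 s j) = e i j) ->
  isomorphic G (@SGraph 'I_k e es ei).
Proof.
move=> injg ss us Gk gs edgeE ltE.
have lt x : index (g x) s < k by rewrite -ss index_mem gs.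
pose f := [ffun x : G => Ordinal (lt x)].
have nthf x : nth x0 s (f x) = g x by rewrite ffunE nth_index.
rewrite /isomorphic /= Gk card_ord eqxx; apply/existsP; exists f; apply/andP; split.
  by apply/injectiveP => x y fxy; apply: injg; rewrite -!nthf fxy.
apply/forallP => x; apply/forallP => y; apply/eqP.
have := ltE (f x) (f y); have := ltE (f y) (f x); rewrite !nthf -!edgeE /=.
case: (ltngtP (f x) (f y)) => [_ _ -> // | _ + _ | fxy _ _].
  by rewrite edge_sym es => ->.
have -> : x = y by apply: injg; rewrite -!nthf fxy.
by rewrite ei edge_irrefl.
Qed.

Section Components.
Variable T : sgraph.
Implicit Types (C X : {set T}).

Lemma componentsP (G : sgraph) (C : {set G}) :
  reflect (exists x, C = [set y | connect (@edge G) x y]) (C \in components G).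
Proof.
apply: (iffP imsetP) => [[x _ ->]|[x ->]]; exists x => //;
  by apply/setP => y; rewrite !inE.
Qed.

Hypothesis conn : forall x y : T, connect (@edge T) x y.

Lemma card_components_connected : #|T| > 0 -> #|components T| = 1.
Proof.
move=> /card_gt0P[r _]; apply/eqP/cards1P; exists setT; apply/setP => C.
rewrite inE; apply/componentsP/eqP => [[x ->]|->].
  by apply/setP => y; rewrite !inE conn.
by exists r; apply/setP => y; rewrite !inE conn.
Qed.

(** Deleting the only edge that leaves [C] makes [C] closed, and [C] stays
connected because it is so without that edge. Both orders of the ends are given,
since [del_edge u v] and [del_edge v u] are different terms and the complement of
[C] calls for the second one. *)
Lemma del_edge_class C u v x :
  branch C -> u \in C -> v \notin C -> edge u v -> x \in C ->
  [set y | connect (@edge (del_edge u v)) x y] = C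
  /\ [set y | connect (@edge (del_edge v u)) x y] = C.
Proof.
move=> bC uC vC euv xC.
have vCC : v \in ~: C by rewrite inE.
have leave a b : a \in C -> b \notin C -> edge a b -> a = u /\ b = v.
  move=> aC bC' eab; have bCC : b \in ~: C by rewrite inE.
  by have [-> ->] := ecount1_unique (eqP bC) uC vCC euv aC bCC eab.
suff cl (w z : T) : [set w; z] = [set u; v] ->
    [set y | connect (@edge (del_edge w z)) x y] = C.
  by split; apply: cl; rewrite // setUC.
move=> wz; set K := [set y | _].
have KC : K \subset C.
  apply/subsetP => y; rewrite inE => /connectP[p]; elim: p x xC {K} => [|c p IH] b bC' /=.
    by move=> _ ->.
  case/andP => /andP[ebc nbc] pc; apply: IH => //.
  apply/negPn/negP => cC; have [bu cv] := leave _ _ bC' cC ebc.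
  by move: nbc; rewrite bu cv wz eqxx.
apply/eqP/negPn/negP => KnC.
have K0 : K != set0 by apply/set0Pn; exists x; rewrite inE connect0.
have [a [b [aK bC' bK eab]]] := branch_connected conn bC KC K0 KnC.
move: bK; rewrite inE => /negP; apply; move: (aK); rewrite inE => xa.
apply: connect_trans xa _; apply: connect1; rewrite /= /del_edge_rel /= eab wz.
apply/eqP => ab; have : v \in [set a; b] by rewrite ab !inE eqxx orbT.
by rewrite !inE => /orP[]/eqP vE; move: vC; rewrite vE ?bC' // (subsetP KC _ aK).
Qed.

Lemma branch_components C u v : branch C -> u \in C -> v \notin C -> edge u v ->
  components (del_edge u v) = [set C; ~: C].
Proof.
move=> bC uC vC euv.
have bC' : branch (~: C) by rewrite branchC.
have inC x (xC : x \in C) := (del_edge_class bC uC vC euv xC).1.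
have inC' x : x \notin C -> [set y | connect (@edge (del_edge u v)) x y] = ~: C.
  move=> xC; apply: (del_edge_class bC' (u := v) (v := u) _ _ _ _).2;
  by rewrite ?inE ?negbK // edge_sym.
apply/setP => X; rewrite !inE; apply/componentsP/orP => [[x ->]|[]/eqP->].
- by have [xC|xC] := boolP (x \in C); [left; rewrite inC|right; rewrite inC'].
- by exists u; rewrite inC.
by exists v; rewrite inC'.
Qed.

Lemma branch_pendent C H : branch C ->
  (forall u v, u \in C -> v \notin C -> isomorphic (@induced (del_edge u v) C) H) ->
  C \in pendent T H.
Proof.
move=> bC iso; have /ecount_gt0P[u [v [uC vC euv]]] : 0 < ecount C (~: C) by rewrite (eqP bC).
rewrite inE in vC; rewrite inE; apply/existsP; exists u; apply/existsP; exists v.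
have T0 : 0 < #|T| by apply/card_gt0P; exists u.
rewrite /cut_edge euv (branch_components bC uC vC euv) cards2.
have -> : C != ~: C by apply/eqP => /setP/(_ u); rewrite inE uC.
by rewrite card_components_connected //= !inE eqxx iso.
Qed.

(** A component after the deletion of an edge can be left only through that
edge, and the subgraph it induces does not see the deletion. *)
Lemma pendent_branch C H : C \in pendent T H -> branch C /\
  exists u v, isomorphic (@induced (del_edge u v) C) H /\
    {in C &, forall x y, @edge (del_edge u v) x y = @edge T x y}.
Proof.
rewrite inE => /existsP[u /existsP[v /and4P[/andP[euv _] comp2 Ccomp iso]]].
have /componentsP[x0 CE] := Ccomp.
have symd : connect_sym (@edge (del_edge u v)).
  by apply: sym_connect_sym => a b; rewrite edge_sym.
have CK : forall x, x \in C -> C = [set y | connect (@edge (del_edge u v)) x y].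
  move=> x; rewrite CE inE => x0x; apply/setP => y; rewrite !inE.
  exact: (same_connect symd).
have leave a b : a \in C -> b \notin C -> edge a b -> [set a; b] = [set u; v].
  move=> aC bC eab; apply/eqP/negPn/negP => nab.
  move: bC; rewrite (CK a aC) inE => /negP; apply.
  by apply: connect1; rewrite /= /del_edge_rel /= eab.
have x0C : x0 \in C by rewrite CE inE connect0.
have [y yC] : exists y, y \notin C.
  apply/existsP; apply: contraLR comp2; rewrite negb_exists => /forallP allC.
  have CT : C = setT by apply/setP => y; rewrite inE; have := allC y; rewrite negbK.
  have -> : components (del_edge u v) = [set setT]; last by rewrite cards1.
  apply/setP => X; rewrite inE; apply/componentsP/eqP => [[z ->]|->].
    by rewrite -CK CT // inE.
  by exists x0; rewrite -CK CT // inE.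
have /ecount_gt0P[a [b [aC bC eab]]] := boundary_gt0 conn x0C yC.
rewrite inE in bC.
have ab := leave _ _ aC bC eab.
split; last first.
  exists u, v; split; first exact: iso.
  move=> p q pC qC; rewrite /= /del_edge_rel /=.
  have -> : [set p; q] != [set u; v]; last by rewrite andbT.
  rewrite -ab; apply/eqP => /setP/(_ b); rewrite !inE eqxx orbT.
  by case/orP=> /eqP bE; move: bC; rewrite bE ?pC ?qC.
have uniq_ab p q : p \in C -> q \notin C -> edge p q -> p = a /\ q = b.
  move=> pC qC epq; have := leave _ _ pC qC epq; rewrite -ab => pq.
  have : p \in [set a; b] by rewrite -pq !inE eqxx.
  have : q \in [set a; b] by rewrite -pq !inE eqxx orbT.
  rewrite !inE => /orP[]/eqP qE /orP[]/eqP pE; rewrite -?pE -?qE //.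
  - by move: qC; rewrite qE aC.
  - by move: qC; rewrite qE aC.
  by move: pC; rewrite pE (negbTE bC).
rewrite /branch /ecount (bigD1 a) //= (bigD1 b) ?inE //= eab.
rewrite big1 ?big1 // => [i /andP[iC ia]|j /andP[jC jb]].
  apply: big1 => j; rewrite inE => jC; case: (boolP (edge i j)) => // eij.
  by have [ie _] := uniq_ab _ _ iC jC eij; rewrite ie eqxx in ia.
rewrite inE in jC; case: (boolP (edge a j)) => // eaj.
by have [_ je] := uniq_ab _ _ aC jC eaj; rewrite je eqxx in jb.
Qed.

Lemma card_pendent C H : C \in pendent T H -> #|C| = #|H|.
Proof.
case/pendent_branch => _ [u [v [/andP[/eqP cC _] _]]].
by rewrite -cC card_sig; apply: eq_card.
Qed.

Lemma branch2_domino C : branch C -> #|C| = 2 -> domino C.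
Proof.
move=> bC /eqP/cards2P[a [b [ab CE]]].
have [|||x [y [xa yC ya exy]]] := branch_connected conn bC (X := [set a]).
- by rewrite sub1set CE !inE eqxx.
- by apply/set0Pn; exists a; rewrite inE.
- by rewrite CE; apply/eqP => /setP/(_ b); rewrite !inE eqxx orbT eq_sym (negbTE ab).
exists a, b; split=> //; move: xa ya yC; rewrite CE !inE => /eqP <- /negbTE-> /= /eqP<-.
by [].
Qed.

Lemma induced_isomorphic k (e : rel 'I_k) es ei C u v (s : seq T) x0 :
  u \in C -> v \notin C -> size s = k -> uniq s -> C =i s ->
  (forall i j : 'I_k, (i < j)%N -> edge (nth x0 s i) (nth x0 s j) = e i j) ->
  isomorphic (@induced (del_edge u v) C) (@SGraph 'I_k e es ei).
Proof.
move=> uC vC ss us Cs ltE.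
refine (@isomorphic_nth k e es ei (@induced (del_edge u v) C) T (@edge T) val s x0 _ _ _ _ _ _ _) => //.
- exact: val_inj.
- by rewrite card_sig -ss -(card_uniqP us); apply: eq_card => x; rewrite -Cs inE.
- by move=> x; rewrite -Cs (valP x).
move=> [x xC] [y yC]; rewrite /= /induced_rel /= /del_edge_rel /=.
have -> : [set x; y] != [set u; v]; last by rewrite andbT.
apply/eqP => /setP/(_ v); rewrite !inE eqxx orbT => /orP[]/eqP vE.
  by rewrite vE xC in vC.
by rewrite vE yC in vC.
Qed.

Lemma pendent_path2 : pendent T (path_graph 2) = branches T 2.
Proof.
apply/setP => C; rewrite [RHS]inE; apply/idP/andP => [pC|[bC /eqP C2]].
  by rewrite (card_pendent pC) card_ord; have [] := pendent_branch pC.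
have [a [b [CE ab eab]]] := branch2_domino bC C2.
apply: branch_pendent => // u v uC vC.
refine (@induced_isomorphic 2 _ _ _ C u v [:: a; b] a uC vC erefl _ _ _) => /=.
- by rewrite inE ab.
- by move=> x; rewrite CE !inE.
by case=> [[|[|?]] // ?] [[|[|?]] // ?].
Qed.

(** The linking edge attaches one end of each domino; listing the other end of
the first domino, the two linked ends, and the other end of the second one
displays a path. *)
Lemma dominoes_path C1 C2 : domino C1 -> domino C2 -> [disjoint C1 & C2] ->
  ecount C1 C2 = 1 -> exists s : seq T, [/\ uniq s, size s = 4, C1 :|: C2 =i s
    & forall x0 (i j : 'I_4), (i < j)%N -> edge (nth x0 s i) (nth x0 s j) = path_rel i j].
Proof.
move=> dom1 dom2 dis e1.
have pt C x : domino C -> x \in C -> exists y, [/\ C = [set x; y], x != y & edge x y].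
  move=> [a [b [-> ab eab]]]; rewrite !inE => /orP[]/eqP->.
    by exists b.
  by exists a; rewrite setUC eq_sym edge_sym.
have /ecount_gt0P[b [c [bC1 cC2 ebc]]] : 0 < ecount C1 C2 by rewrite e1.
have [a [C1E ba eba]] := pt _ _ dom1 bC1.
have [d [C2E cd ecd]] := pt _ _ dom2 cC2.
have aC1 : a \in C1 by rewrite C1E !inE eqxx orbT.
have dC2 : d \in C2 by rewrite C2E !inE eqxx orbT.
have neq x y : x \in C1 -> y \in C2 -> x != y.
  move=> xC yC; apply/eqP => xy; have := disjointFr dis xC.
  by rewrite xy yC.
have non x y : x \in C1 -> y \in C2 -> (x != b) || (y != c) -> edge x y = false.
  move=> xC yC; apply: contraTF => exy.
  by have [-> ->] := ecount1_unique e1 xC yC exy bC1 cC2 ebc; rewrite !eqxx.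
exists [:: a; b; c; d]; split=> //=.
- by rewrite !inE !negb_or cd (eq_sym a) ba !neq.
- by move=> x; rewrite C1E C2E !inE -!orbA; case: (x == a); case: (x == b).
move=> x0; case=> [[|[|[|[|?]]]] // ?] [[|[|[|[|?]]]] // ?] //= _.
- by rewrite edge_sym.
- by apply: non; rewrite // eq_sym ba.
- by apply: non; rewrite // eq_sym ba.
by apply: non; rewrite // [d == c]eq_sym cd orbT.
Qed.

Lemma dominoes_pendent_path4 C1 C2 : domino C1 -> domino C2 -> [disjoint C1 & C2] ->
  ecount C1 C2 = 1 -> branch (C1 :|: C2) -> C1 :|: C2 \in pendent T (path_graph 4).
Proof.
move=> dom1 dom2 dis e1 bU; have [s [us ss Us edges]] := dominoes_path dom1 dom2 dis e1.
apply: branch_pendent => // u v uC vC.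
exact: (@induced_isomorphic 4 _ _ _ _ u v s u uC vC ss us Us (edges u)).
Qed.

Lemma pendent_claw_center C : C \in pendent T claw -> exists2 z, z \in C &
  {in C &, forall x y, x != z -> y != z -> edge x y = false}.
Proof.
case/pendent_branch => _ [u [v [/andP[/eqP cC /existsP[f /andP[/injectiveP injf /forallP fe]]] eE]]].
have [g fg gf] : bijective f by apply: inj_card_bij => //; rewrite cC.
exists (val (g (inl ord0))); first exact: valP.
move=> x y xC yC xz yz.
have out w (wC : w \in C) : w != val (g (inl ord0)) -> is_inl (f (exist _ w wC)) = false.
  move=> wz; case fw: (f _) => [i|] //; move: fw; rewrite (ord1 i) => /(congr1 g).
  by rewrite fg => gz; rewrite -gz eqxx in wz.
have /forallP/(_ (exist _ y yC))/eqP := fe (exist _ x xC).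
rewrite /= /bipartite_rel /= !out // eqxx => /esym.
by rewrite -eE.
Qed.

End Components.

(** * Trees with at most five vertices *)

Section Small.
Variable T : sgraph.
Implicit Types A C : {set T}.
Hypothesis conn : forall x y : T, connect (@edge T) x y.

Lemma whole_isomorphic k (e : rel 'I_k) es ei (s : seq T) x0 :
  size s = k -> uniq s -> #|T| = k ->
  (forall i j : 'I_k, (i < j)%N -> edge (nth x0 s i) (nth x0 s j) = e i j) ->
  isomorphic T (@SGraph 'I_k e es ei).
Proof.
move=> ss us Tk ltE.
refine (@isomorphic_nth k e es ei T T (@edge T) id s x0 _ _ _ _ _ _ _) => //.
move=> x; have : #|s| = #|T| by rewrite (card_uniqP us) ss.
by move=> sT; rewrite (subset_cardP sT (subset_predT _)).
Qed.

Lemma neighbor (x y : T) : x != y -> exists z, edge x z.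
Proof.
move=> xy; have xs : x \in [set x] by rewrite inE.
have ys : y \notin [set x] by rewrite inE eq_sym.
have /ecount_gt0P[a [b [aX _ eab]]] := boundary_gt0 conn xs ys.
by move: aX; rewrite inE => /eqP <-; exists b.
Qed.

Lemma isomorphic_path1 : #|T| = 1 -> isomorphic T (path_graph 1).
Proof.
move=> T1; have /card_gt0P[x _] : 0 < #|T| by rewrite T1.
refine (@whole_isomorphic 1 _ _ _ [:: x] x erefl isT T1 _).
by case=> [[|?] // ?] [[|?] // ?].
Qed.

Lemma isomorphic_path2 : #|T| = 2 -> isomorphic T (path_graph 2).
Proof.
move=> T2; have /eqP/cards2P[a [b [ab TE]]] : #|[set: T]| = 2 by rewrite cardsT.
have [z eaz] := neighbor ab.
have eab : edge a b.
  have : z \in [set: T] by [].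
  by rewrite TE !inE => /orP[]/eqP ze; move: eaz; rewrite ze // edge_irrefl.
refine (@whole_isomorphic 2 _ _ _ [:: a; b] a erefl _ T2 _); first by rewrite /= inE ab.
by case=> [[|[|?]] // ?] [[|[|?]] // ?].
Qed.

Lemma isomorphic_path3 C : branch C -> domino C -> #|T| = 3 -> isomorphic T (path_graph 3).
Proof.
move=> bC domC T3.
have /ecount_gt0P[b [c [bCC cC ebc]]] : 0 < ecount C (~: C) by rewrite (eqP bC).
have [a [CE ab eab]] : exists a, [/\ C = [set a; b], a != b & edge a b].
  move: domC bCC => [a [d [-> ad ead]]]; rewrite !inE => /orP[]/eqP->.
    by exists d; rewrite setUC eq_sym edge_sym.
  by exists a.
have aC : a \in C by rewrite CE !inE eqxx.
have neq x : x \in C -> x != c.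
  by move=> xC; apply/eqP => xc; move: cC; rewrite inE -xc xC.
have eac : edge a c = false.
  apply/negP => eac; have [ba _] := ecount1_unique (eqP bC) bCC cC ebc aC cC eac.
  by rewrite ba eqxx in ab.
refine (@whole_isomorphic 3 _ _ _ [:: a; b; c] a erefl _ T3 _).
  by rewrite /= !inE negb_or ab !neq.
by case=> [[|[|[|?]]] // ?] [[|[|[|?]]] // ?].
Qed.

Lemma isomorphic_path4 C : branch C -> domino C -> #|T| = 4 -> isomorphic T (path_graph 4).
Proof.
move=> bC domC T4.
have C2 : #|C| = 2 by have [a [b [-> ab _]]] := domC; rewrite cards2 ab.
have domC' : domino (~: C).
  by apply: branch2_domino; rewrite ?branchC //; have := cardsC C; rewrite C2 T4; lia.
have dis : [disjoint C & ~: C] by rewrite -setI_eq0 setICr.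
have [s [us ss _ edges]] := dominoes_path domC domC' dis (eqP bC).
have [x0 _] := domC.
exact: (@whole_isomorphic 4 _ _ _ s x0 ss us T4 (edges x0)).
Qed.

(** Each of the other vertices has a neighbor inside the connected set [C], and
the center is the only candidate. *)
Lemma claw_center_adjacent C z : branch C -> 1 < #|C| -> z \in C ->
  {in C &, forall x y, x != z -> y != z -> edge x y = false} ->
  {in C, forall x, x != z -> edge z x}.
Proof.
move=> bC C1 zC claw x xC xz.
have sC : [set x] \subset C by rewrite sub1set.
have x0 : [set x] != set0 by apply/set0Pn; exists x; rewrite inE.
have xC' : [set x] != C by apply: contraTneq C1 => <-; rewrite cards1.
have [a [b [+ bC' _ eab]]] := branch_connected conn bC sC x0 xC'.
rewrite inE => /eqP ax; move: eab; rewrite ax => exb.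
have [bz|bz] := eqVneq b z; first by rewrite -bz edge_sym.
by rewrite claw // in exb.
Qed.

(** The fifth vertex is not attached to the center of the claw: otherwise the
tree would be a star, which has no branch of size 2. *)
Lemma isomorphic_fork C A z : #|T| = 5 -> branch C -> #|C| = 4 -> z \in C ->
  {in C &, forall x y, x != z -> y != z -> edge x y = false} ->
  branch A -> domino A -> isomorphic T fork.
Proof.
move=> T5 bC C4 zC claw bA domA.
have zadj := claw_center_adjacent bC (_ : 1 < #|C|) zC claw.
rewrite C4 in zadj; move: zadj => /(_ isT) zadj.
have /ecount_gt0P[w [y [wC yC ewy]]] : 0 < ecount C (~: C) by rewrite (eqP bC).
have yC1 : ~: C = [set y].
  apply/eqP; rewrite eq_sym eqEcard sub1set yC cards1 /=.
  by have := cardsC C; rewrite C4 T5; lia.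
have leave x : x \in C -> edge x y -> x = w.
  by move=> xC exy; have [->] := ecount1_unique (eqP bC) wC yC ewy xC yC exy.
have inT x : (x \in C) || (x == y).
  by have /setP/(_ x) := yC1; rewrite !inE => <-; case: (x \in C).
have wz : w != z.
  apply/eqP => wz.
  have star x : x != z -> edge z x.
    move=> xz; have /orP[xC|/eqP->] := inT x; first exact: zadj.
    by rewrite -wz.
  have alone x x' : x != z -> x' != z -> edge x x' = false.
    move=> xz xz'; have /orP[xC|/eqP xy] := inT x; have /orP[xC'|/eqP xy'] := inT x'.
    - exact: claw.
    - rewrite xy'; apply/negP => exy; have xw := leave _ xC exy.
      by rewrite xw wz eqxx in xz.
    - rewrite xy edge_sym; apply/negP => exy; have xw := leave _ xC' exy.
      by rewrite xw wz eqxx in xz'.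
    by rewrite xy xy' edge_irrefl.
  have [q AE] : exists q, A = [set z; q].
    have [a [b [-> ab eab]]] := domA.
    have [->|az] := eqVneq a z; first by exists b.
    have [->|bz] := eqVneq b z; first by exists a; rewrite setUC.
    by rewrite alone in eab.
  have A3 : 1 < #|~: A|.
    by have := cardsC A; have := cards2 z q; rewrite -AE T5; case: (z != q); lia.
  have [a [b [aA bA' ab]]] := card_gt1P A3.
  have zA : z \in A by rewrite AE !inE eqxx.
  have out x : x \in ~: A -> edge z x.
    by rewrite inE => xA; apply: star; apply: contraNneq xA => ->.
  have [_ abE] := ecount1_unique (eqP bA) zA aA (out _ aA) zA bA' (out _ bA').
  by rewrite abE eqxx in ab.
have /eqP/cards2P[l1 [l2 [l12 lE]]] : #|C :\ z :\ w| = 2.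
  have := cardsD1 z C; rewrite zC C4; have := cardsD1 w (C :\ z).
  by rewrite !inE wC wz /=; lia.
have [l1w [l1z l1C]] : l1 != w /\ l1 != z /\ l1 \in C.
  by have : l1 \in C :\ z :\ w by [rewrite lE !inE eqxx]; rewrite !inE => /and3P[].
have [l2w [l2z l2C]] : l2 != w /\ l2 != z /\ l2 \in C.
  by have : l2 \in C :\ z :\ w by [rewrite lE !inE eqxx orbT]; rewrite !inE => /and3P[].
have neq x : x \in C -> x != y.
  by move=> xC; apply/eqP => xy; move: yC; rewrite inE -xy xC.
have no x : x \in C -> x != w -> edge x y = false.
  by move=> xC xw; apply: contraNF xw => /(leave _ xC) ->.
refine (@whole_isomorphic 5 _ _ _ [:: z; l1; l2; w; y] z erefl _ T5 _).
  by rewrite /= !inE !negb_or !neq // l12 l1w l2w !(eq_sym z) l1z l2z wz.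
have eqs : [/\ edge z l1, edge z l2, edge z w & edge w y]
  /\ [/\ edge l1 l2 = false, edge l1 w = false & edge l2 w = false]
  /\ [/\ edge z y = false, edge l1 y = false & edge l2 y = false].
  split; first by split; rewrite ?ewy ?zadj.
  by split; split; [exact: claw..|apply: no; rewrite // eq_sym|exact: no|exact: no].
have [[e1 e2 e3 e4] [[e5 e6 e7] [e8 e9 e10]]] := eqs.
by case=> [[|[|[|[|[|?]]]]] // ?] [[|[|[|[|[|?]]]]] // ?] //= _;
  rewrite ?e1 ?e2 ?e3 ?e4 ?e5 ?e6 ?e7 ?e8 ?e9 ?e10.
Qed.

End Small.

(** * The three conditions *)

Section Unique.
Variable T : sgraph.
Implicit Types A B C : {set T}.
Hypothesis conn : forall x y : T, connect (@edge T) x y.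

(** Both dominoes contain the neighbor y of [A]. If their other vertices a and
a' differed, the only edge leaving [A :|: B] would be y a' and the only edge
leaving [A :|: B'] would be y a, so nothing would leave the union of the two and
the tree would have five vertices. *)
Lemma domino_tail_unique A B B' : 5 < #|T| -> branch A -> domino A ->
  [disjoint A & B] -> [disjoint A & B'] -> domino B -> domino B' ->
  ecount A B = 1 -> ecount A B' = 1 -> branch (A :|: B) -> branch (A :|: B') -> B = B'.
Proof.
move=> T6 bA domA dB dB' domB domB' e1 e1' bU bU'.
have /ecount_gt0P[x [y [xA yB exy]]] : 0 < ecount A B by rewrite e1.
have /ecount_gt0P[x' [y' [xA' yB' exy']]] : 0 < ecount A B' by rewrite e1'.
have yA : y \in ~: A by rewrite inE (disjointFl dB yB).
have yA' : y' \in ~: A by rewrite inE (disjointFl dB' yB').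
have [_ yy] := ecount1_unique (eqP bA) xA yA exy xA' yA' exy'.
rewrite -{y' exy' yA'}yy in yB'.
have pt C : domino C -> y \in C -> exists a, [/\ C = [set y; a], y != a & edge y a].
  move=> [a [b [-> ab eab]]]; rewrite !inE => /orP[]/eqP->; first by exists b.
  by exists a; rewrite setUC eq_sym edge_sym.
have [a [BE ya eya]] := pt _ domB yB; have [a' [BE' ya' eya']] := pt _ domB' yB'.
have [aa|aa] := eqVneq a a'; first by rewrite BE BE' aa.
have aA : a \notin A by rewrite (disjointFl dB) // BE !inE eqxx orbT.
have aA' : a' \notin A by rewrite (disjointFl dB') // BE' !inE eqxx orbT.
have aU : a' \in ~: (A :|: B) by rewrite BE !inE (negbTE aA') eq_sym (negbTE ya') eq_sym (negbTE aa).
have aU' : a \in ~: (A :|: B') by rewrite BE' !inE (negbTE aA) eq_sym (negbTE ya) (negbTE aa).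
have yU : y \in A :|: B by rewrite inE yB orbT.
have yU' : y \in A :|: B' by rewrite inE yB' orbT.
pose Z := a' |: (A :|: B).
have ZT : Z = setT.
  apply/setP => q0; rewrite [RHS]inE; apply/negPn/negP => q0Z.
  have yZ : y \in Z by rewrite !inE yB !orbT.
  have /ecount_gt0P[p [q [pZ qZ epq]]] := boundary_gt0 conn yZ q0Z.
  move: qZ; rewrite in_setC !in_setU in_set1 !negb_or => /and3P[qa qA qB].
  have qU : q \in ~: (A :|: B) by rewrite !inE negb_or qA qB.
  have qU' : q \in ~: (A :|: B').
    move: qB; rewrite BE BE' !inE !negb_or qA => /andP[-> _]; exact: qa.
  move: pZ; rewrite in_setU1 => /orP[/eqP pa|pU]; last first.
    have [_ qE] := ecount1_unique (eqP bU) yU aU eya' pU qU epq.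
    by rewrite qE eqxx in qa.
  have pU' : p \in A :|: B' by rewrite pa BE' !inE eqxx !orbT.
  have [yp _] := ecount1_unique (eqP bU') yU' aU' eya pU' qU' epq.
  by rewrite yp pa eqxx in ya'.
have A2 : #|A| = 2 by have [p [q [-> pq _]]] := domA; rewrite cards2 pq.
have B2 : #|B| = 2 by rewrite BE cards2 ya.
move: T6; rewrite -cardsT -ZT cardsU1 cardsU A2 B2 (disjoint_setI0 dB) cards0.
by case: (_ \notin _).
Qed.

End Unique.

Theorem theorem3p2 (T : sgraph) (hT : is_tree T)
    (hsmall : ~~ has (isomorphic T) small_exceptions) :
  #|pendent T (path_graph 2)| = 0
  \/ (#|pendent T (path_graph 2)| = 1 /\ 1 <= #|pendent T claw|)
  \/ (#|pendent T (path_graph 2)| = 2 /\ #|pendent T (path_graph 4)| = 0) ->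
  ~ e_positive T.
Proof.
have [T0 conn _] := hT.
have [r [par [depth [dlt edgeE]]]] := tree_rooting hT.
move: hsmall; rewrite /= !negb_or => /and5P[/negP nP1 /negP nP2 /negP nP3 /negP nP4 /andP[/negP nF _]].
have dominoP := two_dominoesP dlt edgeE conn.
have dominoI := two_dominoes_inj dlt.
set N := two_dominoes r par depth in dominoP dominoI.
have br2 := branch2_domino conn.
rewrite pendent_path2 // => + eT.
have big : 2 < #|T|.
  case: ltngtP (nP1) (nP2) => // [T2 + _ | T2 _]; last by case; exact: isomorphic_path2.
  case; apply: isomorphic_path1; lia.
have N2 : 0 < #|branches T 2| by apply: (branch_of_size dlt edgeE) => //; rewrite big.
case=> [N20|[[N21 hclaw]|[N22 noP4]]]; first by rewrite N20 in N2.
- have /eqP/cards1P[A AE] := N21.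
  have /setIdP[bA /eqP A2] : A \in branches T 2 by rewrite AE inE.
  have uniqA C : branch C -> domino C -> C = A.
    move=> bC [a [b [CE ab _]]]; apply/set1P; rewrite -AE inE bC CE cards2 ab.
    by [].
  have [W Wclaw] := card_gt0P hclaw.
  have [bW _] := pendent_branch conn Wclaw.
  have W4 : #|W| = 4 by rewrite (card_pendent conn Wclaw) card_sum !card_ord.
  have [z zW zclaw] := pendent_claw_center conn Wclaw.
  have domA := br2 _ bA A2.
  have T4 : 4 < #|T|.
    rewrite -W4 -cardsT; apply: proper_card; rewrite properT.
    by apply: contraTneq bW => ->; rewrite /branch setCT ecount_sym ecount_set0l.
  have [T5|T5] := eqVneq #|T| 5.
    by apply: nF; exact: (isomorphic_fork conn T5 bW W4 zW zclaw bA domA).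
  have tail x : x \in N -> exists B, [/\ [set fiber par depth x.1 d | d in x.1 :\ x.2] = [set A; B],
     [disjoint A & B], domino B, branch (A :|: B) & ecount A B = 1].
    case: x => D c /dominoP[C1 [C2 [fam dis dom1 dom2 [[b1 b2]|[bU b1 e1]]]]].
      have /eqP := disjoint_setI0 dis; rewrite (uniqA _ b1 dom1) (uniqA _ b2 dom2) setIid.
      by rewrite -cards_eq0 A2.
    have C1A := uniqA _ b1 dom1; subst C1; by exists C2.
  (* Here n > 5 matters: in the fork the branch [A] extends in two ways. *)
  have N22 : #|N| <= 1.
    apply/card_le1_eqP => x y xN yN; apply: dominoI => //=.
    have [B [-> dB domB bU e1]] := tail x xN; have [B' [-> dB' domB' bU' e1']] := tail y yN.
    congr [set A; _].
    by apply: (domino_tail_unique conn (A := A)); rewrite // ltn_neqAle eq_sym T5.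
  have N4 : #|N| < #|branches T 4|.
    have Wbr : W \in branches T 4 by rewrite inE bW W4.
    have [->|[x xN]] := set_0Vmem N; first by rewrite cards0; apply/card_gt0P; exists W.
    apply: leq_ltn_trans N22 _; apply/card_gt1P.
    have [B [_ dB domB bU _]] := tail x xN.
    have B2 : #|B| = 2 by have [p [q [-> pq _]]] := domB; rewrite cards2 pq.
    exists (A :|: B), W; split=> //.
      by rewrite inE bU cardsU (disjoint_setI0 dB) cards0 A2 B2.
    (* The center of a claw would belong to both dominoes, as it meets every
       edge. *)
    apply/eqP => UW; rewrite -UW in zW zclaw.
    have edgez (C : {set T}) : C \subset A :|: B -> domino C -> z \in C.
      move=> /subsetP sC [a [b [CE ab eab]]].
      apply/negPn/negP => zC; move: eab; rewrite zclaw //.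
      - by apply: sC; rewrite CE !inE eqxx.
      - by apply: sC; rewrite CE !inE eqxx orbT.
      - by apply: contraNneq zC => <-; rewrite CE !inE eqxx.
      by apply: contraNneq zC => <-; rewrite CE !inE eqxx orbT.
    have := disjointFr dB (edgez _ (subsetUl _ _) domA).
    by rewrite edgez // subsetUr.
  have := branches_vs_dominoes dlt edgeE T4 eT; rewrite N21 -/N.
  by move: T4 T5 N22 N4; clear; nia.
have [A Abr] := card_gt0P N2; have /setIdP[bA /eqP A2] := Abr.
have domA := br2 _ bA A2.
have T4 : 4 < #|T|.
  case: (ltngtP #|T| 3) => [|T3|T3]; first by lia.
    rewrite ltn_neqAle T3 andbT eq_sym; apply/eqP => T4.
    by apply: nP4; exact: (isomorphic_path4 conn bA domA T4).
  by case: nP3; exact: (isomorphic_path3 bA domA T3).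
have fam2 x : x \in N -> [set fiber par depth x.1 d | d in x.1 :\ x.2] = branches T 2.
  case: x => D c /dominoP[C1 [C2 [/= -> dis dom1 dom2 cases]]].
  case: cases => [[b1 b2]|[bU b1 e1]]; last first.
    have := dominoes_pendent_path4 conn dom1 dom2 dis e1 bU.
    by rewrite (cards0_eq noP4) inE.
  have c1 : #|C1| = 2 by have [p [q [-> pq _]]] := dom1; rewrite cards2 pq.
  have c2 : #|C2| = 2 by have [p [q [-> pq _]]] := dom2; rewrite cards2 pq.
  apply/eqP; rewrite eqEcard N22 cards2.
  have -> : C1 != C2.
    by apply/eqP => CC; move: c1; rewrite -[C1]setIid {2}CC (disjoint_setI0 dis) cards0.
  rewrite andbT; apply/subsetP => C; rewrite in_set2 => /orP[]/eqP->;
  by rewrite inE ?b1 ?b2 ?c1 ?c2.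
have N1 : #|N| <= 1.
  by apply/card_le1_eqP => x y xN yN; apply: dominoI => //=; rewrite !fam2.
have N4 : 0 < #|branches T 4| by apply: (branch_of_size dlt edgeE) => //; rewrite T4.
have := branches_vs_dominoes dlt edgeE T4 eT; rewrite N22 -/N.
by move: T4 N1 N4; clear; nia.
Qed.
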